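(* Let $A$ be a unital C*-algebra and $\pi: A\to B(H)$ a non-degenerate representation of $A$ on a Hilbert space $H$ such that $\mathrm{WE}(\pi)\neq\emptyset$. For every $\phi\in\mathrm{WE}(\pi)$ there exists a probability (Baire) measure $\mu_\phi$ on $\mathrm{WE}(\pi)$ which vanishes on every Baire subset of $\mathrm{WE}(\pi)$ disjoint from the set of extreme points of $\mathrm{WE}(\pi)$ and which satisfies $$ f^S_{(h,k)}(\phi) = \int_{\mathrm{WE}(\pi)} f^S_{(h,k)}\, \mathrm{d}\mu_\phi $$ for every $S\in B(H)$ and all $h,k\in H$.
   Context: $\pi(A)''$ denotes the double commutant of $\pi(A)$ in $B(H)$. A weak expectation of $\pi$ is a unital completely positive map $\theta: B(H)\to\pi(A)''$ with $\theta(\pi(a))=\pi(a)$ for all $a\in A$; $\mathrm{WE}(\pi)$ is the set of all weak expectations of $\pi$. Let $E = \mathrm{CB}(B(H),\pi(A)'')$ be the space of completely bounded maps from $B(H)$ to $\pi(A)''$ with the BW-topology (bounded-weak topology), a locally convex topological vector space. On norm-bounded subsets of $E$, a net $\theta_\lambda$ converges to $\theta$ in this topology iff $\langle\theta_\lambda(S)h,k\rangle\to\langle\theta(S)h,k\rangle$ for all $S\in B(H)$, $h,k\in H$. $\mathrm{WE}(\pi)$ carries the relative BW-topology, in which it is a compact convex set; Baire sets are taken with respect to this topology. For $S\in B(H)$ and $h,k\in H$, $f^S_{(h,k)}: E\to\mathbb{C}$ is the continuous linear functional $f^S_{(h,k)}(\theta) = \langle\theta(S)h,k\rangle$. *)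

(* Defs.v *)
From HB Require Import structures.
From mathcomp Require Import all_boot all_order all_algebra.
From mathcomp Require Import sesquilinear complex.
From mathcomp Require Import all_classical all_reals all_analysis.
From mathcomp Require Import ring lra.

Set Implicit Arguments.
Unset Strict Implicit.
Unset Printing Implicit Defensive.

Import Order.TTheory GRing.Theory Num.Theory.
Import numFieldNormedType.Exports.

Local Open Scope classical_set_scope.
Local Open Scope ring_scope.

(* The form is linear in its first argument and conjugate-linear in the
   second one. *)
HB.mixin Record hasInner (R : realType) H & CompleteNormedModule R[i] H := {
  inner : {dot H for @Num.conj R[i]};
  inner_norm : forall x : H, `|x| ^+ 2 = inner x x
}.

#[short(type="hilbertType")]
HB.structure Definition Hilbert (R : realType) :=
  {H of hasInner R H & CompleteNormedModule R[i] H}.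

(* The product is part of the mixin: a join of the ring structures with
   normed modules cannot be declared above numDomainType.  The zero algebra
   (cone = 0) is allowed. *)
HB.mixin Record isCStarAlgebra (R : realType) A
    & CompleteNormedModule R[i] A := {
  cone : A;
  cmul : A -> A -> A;
  star : A -> A;
  cmulA : associative cmul;
  cmul1l : left_id cone cmul;
  cmul1r : right_id cone cmul;
  cmulDl : left_distributive cmul +%R;
  cmulDr : right_distributive cmul +%R;
  cmulZl : forall (c : R[i]) (a b : A), cmul (c *: a) b = c *: cmul a b;
  cmulZr : forall (c : R[i]) (a b : A), cmul a (c *: b) = c *: cmul a b;
  starK : involutive star;
  starD : {morph star : a b / a + b};
  starZ : forall (c : R[i]) (a : A), star (c *: a) = Num.conj c *: star a;
  starM : forall a b : A, star (cmul a b) = cmul (star b) (star a);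
  cmul_norm : forall a b : A, `|cmul a b| <= `|a| * `|b|;
  star_norm : forall a : A, `|cmul (star a) a| = `|a| ^+ 2
}.

#[short(type="cstarAlgType")]
HB.structure Definition CStarAlgebra (R : realType) :=
  {A of isCStarAlgebra R A & CompleteNormedModule R[i] A}.

Section BoundedOperators.
Context (R : realType) (H : hilbertType R).

Definition bounded_op : {pred H -> H} := fun f =>
  `[< linear f /\ exists M : R[i], forall x, `|f x| <= M * `|x| >].

Record bop := Bop { bop_fun :> H -> H ; _ : bop_fun \in bounded_op }.

HB.instance Definition _ := [isSub for bop_fun].
HB.instance Definition _ := [Choice of bop by <:].

Lemma bopP (f : bop) :
  linear f /\ exists M : R[i], forall x, `|f x| <= M * `|x|.
Proof. by case: f => f /= /asboolP. Qed.

Lemma bounded_op_submod_closed : submod_closed bounded_op.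
Proof.
split.
  apply/asboolP; split; first by move=> a x y /=; rewrite scaler0 addr0.
  by exists 0 => x; rewrite mul0r normr0.
move=> a f g /asboolP[lf [M fM]] /asboolP[lg [N gN]].
apply/asboolP; split=> [c x y|].
  rewrite !fctE lf lg !scalerDr !scalerA [a * c]mulrC.
  by rewrite !addrA; congr (_ + _); rewrite -!addrA; congr (_ + _); rewrite addrC.
exists (`|a| * M + N) => x; rewrite mulrDl -mulrA.
rewrite (le_trans (ler_normD _ _))// lerD//.
by rewrite normrZ ler_wpM2l.
Qed.

HB.instance Definition _ :=
  GRing.isSubmodClosed.Build _ _ bounded_op bounded_op_submod_closed.
HB.instance Definition _ := [SubChoice_isSubLmodule of bop by <:].

Lemma bounded_op_id : (id : H -> H) \in bounded_op.
Proof. by apply/asboolP; split => //; exists 1 => x; rewrite mul1r. Qed.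

Lemma bounded_op_comp (f g : bop) : (f \o g : H -> H) \in bounded_op.
Proof.
have [lf [M fM]] := bopP f; have [lg [N gN]] := bopP g.
apply/asboolP; split=> [a x y|]; first by rewrite /= lg lf.
exists (`|M| * `|N|) => x /=; rewrite -mulrA.
have nle (K r : R[i]) (t : R[i]) : 0 <= r -> t <= K * r -> 0 <= t -> t <= `|K| * r.
  move=> r0 tK t0.
  by rewrite -[r in leRHS]ger0_norm// -normrM ger0_norm ?(le_trans t0).
rewrite (le_trans (nle M _ _ _ (fM _) _))// ler_wpM2l// nle//.
Qed.

Definition bop1 := Bop bounded_op_id.
Definition bop_mul (f g : bop) := Bop (bounded_op_comp f g).

Lemma bop_ext (f g : bop) : f =1 g -> f = g.
Proof. by move=> fg; apply/val_inj/funext. Qed.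

Lemma bop_mulA : associative bop_mul. Proof. by move=> f g h; exact: bop_ext. Qed.
Lemma bop_mul1l : left_id bop1 bop_mul. Proof. by move=> f; exact: bop_ext. Qed.
Lemma bop_mul1r : right_id bop1 bop_mul. Proof. by move=> f; exact: bop_ext. Qed.
Lemma bop_mulDl : left_distributive bop_mul +%R.
Proof. by move=> f g h; exact: bop_ext. Qed.
Lemma bop_mulDr : right_distributive bop_mul +%R.
Proof.
move=> f g h; apply: bop_ext => x; have [lf _] := bopP f.
by have := lf 1 (g x) (h x); rewrite !scale1r.
Qed.

HB.instance Definition _ := GRing.Zmodule_isPzRing.Build bop
  bop_mulA bop_mul1l bop_mul1r bop_mulDl bop_mulDr.

End BoundedOperators.

Notation "''B(' H )" := (bop H) (format "''B(' H )") : type_scope.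

Section OperatorMatrices.
Context (R : realType) (H : hilbertType R).
Implicit Types (n : nat).

(* The action of S in M_n(B(H)) = B(H^n) on H^n. *)
Definition opmx_act n (S : 'M['B(H)]_n) (x : 'I_n -> H) : 'I_n -> H :=
  fun i => \sum_j S i j (x j).

(* Norms of elements of H live in R[i], hence the real part. *)
Definition l2norm n (x : 'I_n -> H) : R :=
  Num.sqrt (\sum_i complex.Re `|x i| ^+ 2).

Definition opmx_norm n (S : 'M['B(H)]_n) : \bar R :=
  ereal_sup [set (l2norm (opmx_act S x))%:E | x in [set x | l2norm x <= 1]].

(* Positivity in M_n(B(H)); 0 <= z in R[i] means that z is real and
   nonnegative. *)
Definition opmx_ge0 n (S : 'M['B(H)]_n) :=
  forall x : 'I_n -> H, 0 <= \sum_i inner (opmx_act S x i) (x i).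

Definition cb_norm (theta : 'B(H) -> 'B(H)) : \bar R :=
  ereal_sup [set y | exists n (S : 'M['B(H)]_n),
    (opmx_norm S <= 1)%E /\ y = opmx_norm (map_mx theta S)].

Definition completely_positive (theta : 'B(H) -> 'B(H)) :=
  forall n (S : 'M['B(H)]_n), opmx_ge0 S -> opmx_ge0 (map_mx theta S).

Definition commutant (X : set 'B(H)) : set 'B(H) :=
  [set T | forall S, X S -> T * S = S * T].

Definition bicommutant (X : set 'B(H)) := commutant (commutant X).

Definition cb_map (X : set 'B(H)) : {pred 'B(H) -> 'B(H)} := fun theta =>
  `[< [/\ linear theta, forall S, bicommutant X (theta S) &
          (cb_norm theta < +oo)%E] >].

Lemma Re_norm_ge0 (z : H) : 0 <= complex.Re `|z|.
Proof. by have := normr_ge0 z; rewrite lecE => /andP[]. Qed.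

Lemma l2normDZ n (a : R[i]) (u v : 'I_n -> H) :
  l2norm (fun i => a *: u i + v i) <=
  2 * (complex.Re `|a| * l2norm u + l2norm v).
Proof.
have a0 : 0 <= complex.Re `|a| by have := normr_ge0 a; rewrite lecE => /andP[].
have l0 (w : 'I_n -> H) : 0 <= \sum_i complex.Re `|w i| ^+ 2.
  by apply: sumr_ge0 => i _; exact: sqr_ge0.
rewrite -[leRHS]ger0_norm; last first.
  by rewrite mulr_ge0 // addr_ge0 // ?mulr_ge0 // sqrtr_ge0.
rewrite -sqrtr_sqr ler_wsqrtr//.
have reE (z : H) : `|z| = (complex.Re `|z|)%:C%C.
  by have := normr_ge0 z; rewrite lecE => /andP[/eqP]; case: `|z| => p q /= ->.
have aE : `|a| = (complex.Re `|a|)%:C%C.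
  by have := normr_ge0 a; rewrite lecE => /andP[/eqP]; case: `|a| => p q /= ->.
have pw i : complex.Re `|a *: u i + v i| <=
    complex.Re `|a| * complex.Re `|u i| + complex.Re `|v i|.
  have := ler_normD (a *: u i) (v i).
  rewrite normrZ aE (reE (u i)) (reE (v i)) (reE (_ + _)).
  by rewrite -rmorphM -rmorphD /= lecR.
apply: (@le_trans _ _ (\sum_i (2 * complex.Re `|a| ^+ 2 * complex.Re `|u i| ^+ 2
                          + 2 * complex.Re `|v i| ^+ 2))).
  apply: ler_sum => i _.
  apply: (@le_trans _ _ ((complex.Re `|a| * complex.Re `|u i| + complex.Re `|v i|) ^+ 2)).
    by rewrite ler_sqr ?nnegrE ?addr_ge0 ?mulr_ge0 ?Re_norm_ge0 ?pw.
  rewrite -subr_ge0; have := sqr_ge0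
    (complex.Re `|a| * complex.Re `|u i| - complex.Re `|v i|).
  by congr (_ <= _); rewrite sqrrB sqrrD !exprMn; ring.
rewrite big_split -!mulr_sumr.
have l2E (w : 'I_n -> H) : \sum_i complex.Re `|w i| ^+ 2 = l2norm w ^+ 2.
  by rewrite sqr_sqrtr.
rewrite !l2E.
have l2_ge0 (w : 'I_n -> H) : 0 <= l2norm w by exact: sqrtr_ge0.
have := sqr_ge0 (complex.Re `|a| * l2norm u).
have := sqr_ge0 (l2norm v).
have : 0 <= complex.Re `|a| * l2norm u * l2norm v by rewrite !mulr_ge0.
move: (complex.Re `|a|) (l2norm u) (l2norm v) => p q r *.
rewrite -[leLHS]/(2 * p ^+ 2 * q ^+ 2 + 2 * r ^+ 2); nra.
Qed.

Lemma cb_normP (theta : 'B(H) -> 'B(H)) : (cb_norm theta < +oo)%E <->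
  exists M : R, forall n (S : 'M['B(H)]_n), (opmx_norm S <= 1)%E ->
    forall x, l2norm x <= 1 -> l2norm (opmx_act (map_mx theta S) x) <= M.
Proof.
split=> [cb|[M thM]]; last first.
  apply: (@le_lt_trans _ _ M%:E); last exact: ltry.
  apply: ge_ereal_sup => _ [n [S [S1 ->]]].
  by apply: ge_ereal_sup => _ [x x1 <-]; rewrite lee_fin thM.
have [M cbM] : exists M : R, (cb_norm theta <= M%:E)%E.
  case: (cb_norm theta) cb => [r _|//|_]; first by exists r.
  by exists 0; rewrite leNye.
exists M => n S S1 x x1; rewrite -lee_fin (le_trans _ cbM)//.
apply: (@le_trans _ _ (opmx_norm (map_mx theta S))).
  by apply: ereal_sup_ubound; exists x.
by apply: ereal_sup_ubound; exists n, S.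
Qed.

Lemma cb_map_submod_closed (X : set 'B(H)) : submod_closed (cb_map X).
Proof.
split.
  apply/asboolP; split.
  - by move=> a S T; rewrite scaler0 addr0.
  - by move=> S T _; rewrite mul0r mulr0.
  - apply/cb_normP; exists 0 => n S _ x _.
    rewrite /l2norm big1 ?sqrtr0// => i _; rewrite /opmx_act big1.
      by rewrite normr0 /= expr0n.
    by move=> j _; rewrite mxE.
move=> a th1 th2 /asboolP[l1 c1 /cb_normP[M1 b1]] /asboolP[l2 c2 /cb_normP[M2 b2]].
apply/asboolP; split.
- move=> c S T; rewrite !fctE l1 l2 !scalerDr !scalerA [a * c]mulrC.
  by rewrite !addrA; congr (_ + _); rewrite -!addrA; congr (_ + _); rewrite addrC.
- move=> S T XT; have /(congr1 (fun f : 'B(H) => bop_fun f)) e1 := c1 S T XT.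
  have /(congr1 (fun f : 'B(H) => bop_fun f)) e2 := c2 S T XT.
  apply: bop_ext => x; have [lT _] := bopP T.
  have := congr1 (@^~ x) e1; have := congr1 (@^~ x) e2 => /= {}e2 {}e1.
  by rewrite /= !fctE /= e1 e2 -lT.
- have a0 : 0 <= complex.Re `|a| by have := normr_ge0 a; rewrite lecE => /andP[].
  apply/cb_normP; exists (2 * (complex.Re `|a| * M1 + M2)) => n S S1 x x1.
  rewrite (_ : opmx_act _ x = fun i => a *: opmx_act (map_mx th1 S) x i
                                       + opmx_act (map_mx th2 S) x i).
    apply: (le_trans (l2normDZ _ _ _)).
    by rewrite ler_pM2l// lerD ?ler_wpM2l ?b1 ?b2.
  apply/funext => i; rewrite /opmx_act scaler_sumr -big_split /=.
  by apply: eq_bigr => j _; rewrite !mxE.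
Qed.

End OperatorMatrices.

Section CompletelyBoundedMaps.
Context (R : realType) (H : hilbertType R) (X : set 'B(H)).

HB.instance Definition _ :=
  GRing.isSubmodClosed.Build _ _ (cb_map X) (@cb_map_submod_closed R H X).

(* CB(B(H), X'') *)
Record cbmap := CBMap { cb_fun :> 'B(H) -> 'B(H) ; _ : cb_fun \in cb_map X }.

HB.instance Definition _ := [isSub for cb_fun].
HB.instance Definition _ := [Choice of cbmap by <:].
HB.instance Definition _ := [SubChoice_isSubLmodule of cbmap by <:].

Definition wfun (S : 'B(H)) (h k : H) (theta : cbmap) : R[i] :=
  inner (theta S h) k.

Definition cb_ball (r : R) : set cbmap :=
  [set theta : cbmap | (cb_norm theta <= r%:E)%E].

(* U is relatively open in B for the topology of pointwise convergence in the
   weak operator topology. *)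
Definition pointwise_weak_open_in (B U : set cbmap) :=
  forall theta, B theta -> U theta ->
  exists (s : seq ('B(H) * H * H)) (e : R[i]), 0 < e /\
    forall eta, B eta ->
      (forall p, p \in s ->
        `|wfun p.1.1 p.1.2 p.2 eta - wfun p.1.1 p.1.2 p.2 theta| < e) ->
      U eta.

(* Arveson's definition of the BW-topology: the convex sets whose trace on
   each ball is relatively open in the above sense form a base. *)
Definition bw_base : set (set cbmap) :=
  [set U | convex_set U /\
           forall r : R, pointwise_weak_open_in (cb_ball r) U].

HB.instance Definition _ :=
  isSubBaseTopological.Build cbmap bw_base (fun U => U).

End CompletelyBoundedMaps.

Arguments bw_base {R H} X.

Definition extreme_points (K : numDomainType) (V : lmodType K) (C : set V) :
    set V :=
  [set x | C x /\ forall y z (t : K), C y -> C z -> 0 < t < 1 ->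
             x = t *: y + (1 - t) *: z -> y = x /\ z = x].

Section WeakExpectations.
Context (R : realType) (A : cstarAlgType R) (H : hilbertType R).

Definition representation (pi : A -> 'B(H)) :=
  [/\ linear pi,
      forall a b, pi (cmul a b) = pi a * pi b &
      forall a h k, inner (pi (star a) h) k = inner h (pi a k)].

(* The linear span of pi(A)H is dense in H. *)
Definition nondegenerate_rep (pi : A -> 'B(H)) :=
  closure [set x : H | exists n (a : 'I_n -> A) (h : 'I_n -> H),
                         x = \sum_i pi (a i) (h i)] = setT.

Definition WE (pi : A -> 'B(H)) : set (cbmap (range pi)) :=
  [set theta : cbmap (range pi) |
    [/\ completely_positive theta, theta 1 = 1 &
        forall a, theta (pi a) = pi a]].

End WeakExpectations.

Arguments WE {R A H} pi.

(* The space T with its Baire sets.  The measurable types of the library are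
   pointed; the point x0 plays no other role. *)
Definition baireType (R : realType) (T : topologicalType) (x0 : T) : Type := T.

Arguments baireType R {T} x0.

Definition baire_generators (R : realType) (T : topologicalType) :
    set (set T) :=
  [set B | exists2 f : T -> R, continuous f &
             exists2 Y, measurable Y & B = f @^-1` Y].

Arguments baire_generators R T : clear implicits.

Definition baire_display : measure_display.
Proof. exact: default_measure_display. Qed.

Section Baire.
Context (R : realType) (T : topologicalType) (x0 : T).

Let G : set (set T) := baire_generators R T.

Lemma baire_setC (B : set T) : <<s G >> B -> <<s G >> (~` B).
Proof. by move=> mB; rewrite -setTD; exact: sigma_algebraCD. Qed.

HB.instance Definition _ := Choice.on (baireType R x0).
HB.instance Definition _ := isPointed.Build (baireType R x0) x0.
HB.instance Definition _ := @isMeasurable.Build baire_display (baireType R x0)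
  <<s G >> (@sigma_algebra0 _ setT G) baire_setC
  (@sigma_algebra_bigcup _ setT G).

End Baire.

Definition cintegrable d (T : measurableType d) (R : realType)
    (mu : {measure set T -> \bar R}) (f : T -> R[i]) :=
  mu.-integrable setT (fun x => (complex.Re (f x))%:E) /\
  mu.-integrable setT (fun x => (complex.Im (f x))%:E).

Definition cintegral d (T : measurableType d) (R : realType)
    (mu : {measure set T -> \bar R}) (f : T -> R[i]) : R[i] :=
  Complex (\int[mu]_x complex.Re (f x)) (\int[mu]_x complex.Im (f x)).

(* Main.v *)
(* The theorem is the Choquet-Bishop-de Leeuw theorem for the compact convex set
   K = WE(pi) and the coordinate functions of its elements.

   Choquet-Bishop-de Leeuw: by Zorn's lemma there is a minimal monotone
   sublinear functional q on C(K) which is below the evaluation at phi on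
   concave functions and satisfies q f = inf {q w | w >= f, w concave}.
   Minimality makes q linear on differences of concave functions, hence
   q a = a(phi) for affine a.  If u_n increases to 0 on the extreme points, then
   q(u_n) tends to 0: this follows from Simons' inequality applied to concave
   majorants of the u_n, as a continuous concave function attains its minimum
   at an extreme point (Bauer).  So q satisfies Daniell's condition on the set
   of extreme points, and the resulting measure does not see any set disjoint
   from it.

   Compactness of K: an ultrafilter limit of the coordinates <theta(S) h, k> is
   a bounded form, hence given by an operator.  The bound is uniform because a
   unital completely positive map is contractive, which is seen on the positive
   operator matrices [[1, S], [S^*, 1]]; the same bound gives cb_norm <= 1, and
   on a ball the BW-topology is the pointwise weak topology. *)

Require Import Defs.
From HB Require Import structures.
From mathcomp Require Import all_boot all_order all_algebra.
From mathcomp Require Import sesquilinear complex finmap.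
From mathcomp Require Import all_classical all_reals all_analysis.
From mathcomp Require Import measurable_realfun.
From mathcomp Require Import ring lra.

Set Implicit Arguments.
Unset Strict Implicit.
Unset Printing Implicit Defensive.

Import Order.TTheory GRing.Theory Num.Theory.
Import numFieldNormedType.Exports.

Local Open Scope classical_set_scope.
Local Open Scope ring_scope.

(** * Continuous concave functions and extreme points *)

(** The set of extreme points of a non-metrizable compact convex set need not be Baire, nor even
    Borel, so concentration on it can only be stated through the Baire sets that miss it. The outer
    measure is therefore built to test coverings on the extreme points alone; vanishing off them is
    then automatic, and the burden moves to showing that the total mass is still 1, which is where
    Simons' inequality enters. For the same lack of a metric there is in general no strictly concave
    continuous function to optimize, and minimality under Zorn's lemma takes its place: q f = inf {q
    w | w >= f, w concave} is the counterpart of maximality of a measure in the Choquet order, and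
    it supplies the concave majorants to which Simons' argument applies. Convexity enters as a
    ternary relation [cmb], since the compact space is a subtype without vector operations, and all
    scalars are real: Im <x, y> = Re <x, i y> turns imaginary parts into further real
    coordinates. *)

Section ContinuousConcave.
Context (R : realType) (T : topologicalType).
(* [cmb t y z x] reads x = t y + (1 - t) z *)
Context (cmb : R -> T -> T -> T -> Prop).
Implicit Types (f g w : T -> R) (c t : R) (x y z : T).

Definition ccv w := continuous w /\
  forall t y z x, 0 < t < 1 -> cmb t y z x -> t * w y + (1 - t) * w z <= w x.

Definition ext_points : set T :=
  [set x | forall t y z, 0 < t < 1 -> cmb t y z x -> y = x /\ z = x].

Lemma continuous_fctD f g : continuous f -> continuous g -> continuous (f + g).
Proof. by move=> cf cg x; apply: cvgD; [exact: cf|exact: cg]. Qed.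

Lemma continuous_fctB f g : continuous f -> continuous g -> continuous (f - g).
Proof. by move=> cf cg x; apply: cvgB; [exact: cf|exact: cg]. Qed.

Lemma continuous_fctZ c f : continuous f -> continuous (c \*o f).
Proof. by move=> cf x; apply: cvgMr; exact: cf. Qed.

Lemma continuous_fct_min f g :
  continuous f -> continuous g -> continuous (f \min g).
Proof. by move=> cf cg x; apply: continuous_min; [exact: cf|exact: cg]. Qed.

Lemma ccv_cst c : ccv (cst c).
Proof. by split=> [x|t y z x _ _] /=; [exact: cvg_cst|lra]. Qed.

Lemma ccvD f g : ccv f -> ccv g -> ccv (f + g).
Proof.
move=> [cf vf] [cg vg]; split; first exact: continuous_fctD.
by move=> t y z x t01 C; rewrite !fctE; have := vf _ _ _ _ t01 C;
  have := vg _ _ _ _ t01 C; lra.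
Qed.

Lemma ccvZ c f : 0 <= c -> ccv f -> ccv (c \*o f).
Proof.
move=> c0 [cf vf]; split; first exact: continuous_fctZ.
move=> t y z x t01 C /=; have := vf _ _ _ _ t01 C.
by move=> /(ler_wpM2l c0); lra.
Qed.

Lemma ccv_min f g : ccv f -> ccv g -> ccv (f \min g).
Proof.
move=> [cf vf] [cg vg]; split; first exact: continuous_fct_min.
move=> t y z x /andP[t0 t1] C /=.
have t01 : 0 < t < 1 by rewrite t0.
rewrite le_min; apply/andP; split.
  apply: le_trans (vf _ _ _ _ t01 C).
  by apply: lerD; rewrite ler_pM2l ?subr_gt0// ge_min lexx.
apply: le_trans (vg _ _ _ _ t01 C).
by apply: lerD; rewrite ler_pM2l ?subr_gt0// ge_min lexx orbT.
Qed.

Context (cT : compact [set: T]) (x0 : T).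

Lemma continuous_argmin f : continuous f -> exists x, forall y, f x <= f y.
Proof.
move=> cf; have [|x _ fx] := compact_EVT_min _ cT (continuous_subspaceT cf).
  by exists x0.
by exists x => y; apply: fx; rewrite inE.
Qed.

Lemma continuous_lbound f : continuous f -> exists m, forall x, m <= f x.
Proof. by move=> /continuous_argmin[x fx]; exists (f x). Qed.

Lemma continuous_ubound f : continuous f -> exists m, forall x, f x <= m.
Proof.
move=> cf; have /continuous_lbound[m fm] : continuous (-1 \*o f).
  exact: continuous_fctZ.
by exists (- m) => x; have := fm x => /=; lra.
Qed.

Context (sep : forall x y, x <> y -> exists2 w, ccv w & w x <> w y).

Let extremal (F : set T) := forall t y z x,
  0 < t < 1 -> cmb t y z x -> F x -> F y /\ F z.

Let face (F : set T) := [/\ closed F, F !=set0 & extremal F].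

(** [Zorn_bigcup] produces maximal sets, so faces are encoded by complements: U stands for the face
    M minus U. Adjoining the complement of M keeps the faces inside M and makes the empty chain
    stand for M itself; for the other chains compactness gives a common point. *)
Lemma minimal_face M : face M ->
  exists F, [/\ face F, F `<=` M & forall G, face G -> G `<=` F -> G = F].
Proof.
move=> faceM.
have [F FP|U [faceU maxU]] := @Zorn_bigcup T (fun U => face (~` (U `|` ~` M))).
  move=> totF.
  have -> : ~` (\bigcup_(X in F) X `|` ~` M) =
      M `&` \bigcap_(X in F) ~` (X `|` ~` M).
    apply/seteqP; split=> [x nx|x [Mx Fx] [[X FX Xx]|//]].
      split; first by apply: contrapT => Mx; apply: nx; right.
      move=> X FX [Xx|Mx]; first by apply: nx; left; exists X.
      by apply: nx; right.
    by apply: (Fx X FX); left.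
  have [clM neM exM] := faceM.
  split.
  - apply: closedI => //; apply: closed_bigI => X FX.
    by have [] := FP _ FX.
  - have [[X0 FX0]|nF] := pselect (F !=set0); last first.
      have [m Mm] := neM; exists m; split=> // X FX.
      by exfalso; apply: nF; exists X.
    have FF : ProperFilter (filter_from F (fun X => ~` (X `|` ~` M))).
      apply: filter_from_proper; last by move=> X /FP[].
      apply: filter_from_filter; first by exists X0.
      move=> X Y FX FY; have [XY|YX] := totF _ _ FX FY.
        exists Y => // x nx; split=> // -[Xx|Mx]; apply: nx.
          by left; exact: XY.
        by right.
      exists X => // x nx; split=> // -[Xx|Mx]; apply: nx.
        by left; exact: YX.
      by right.
    have [|p [_ clp]] := cT FF; first exact: filterT.
    have pF X : F X -> (~` (X `|` ~` M)) p.
      move=> FX; have [clX _ _] := FP _ FX; apply: clX => B Bp.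
      by apply: clp => //; exists X.
    exists p; split; last by move=> X /pF.
    by apply: contrapT => Mp; apply: (pF _ FX0); right.
  - move=> t y z x t01 C [Mx Fx].
    have [My Mz] := exM _ _ _ _ t01 C Mx.
    by split; split=> // X FX; have [_ _ exX] := FP _ FX;
      have [] := exX _ _ _ _ t01 C (Fx _ FX).
exists (~` (U `|` ~` M)); split=> //.
  by move=> x nx; apply: contrapT => Mx; apply: nx; right.
move=> G faceG GU.
apply: contrapT => nGU.
have GM : ~` (~` G `|` ~` M) = G.
  rewrite setCU !setCK; apply/setIidPl => x /GU nx.
  by apply: contrapT => Mx; apply: nx; right.
apply: (maxU (~` G)); last by rewrite GM.
rewrite properEneq; split.
  apply/eqP => UG; apply: nGU.
  by rewrite UG GM.
by move=> x Ux Gx; apply: (GU _ Gx); left.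
Qed.

(** The points where a concave function attains its minimum over a face form a face again. Inside
    the minimizers of w take a minimal face: every concave function is constant on it, so by [sep]
    it is a single point, and a one-point face is an extreme point. *)
Lemma bauer_min w : ccv w -> exists2 x, ext_points x & forall y, w x <= w y.
Proof.
have face_argmin F p a : ccv a -> face F -> F p ->
    (forall q, F q -> a p <= a q) -> face (F `&` [set q | a q <= a p]).
  move=> [ca va] [clF _ exF] Fp pmin; split.
  - apply: closedI => //.
    rewrite (_ : [set q | _] = a @^-1` [set r | r <= a p])//.
    by apply: closed_comp => [q _|]; [exact: ca|exact: closed_le].
  - by exists p; split => /=.
  - move=> t y z x /andP[t0 t1] C [Fx /= xp].
    have t01 : 0 < t < 1 by rewrite t0.
    have [Fy Fz] := exF _ _ _ _ t01 C Fx.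
    have := va _ _ _ _ t01 C.
    move: (pmin _ Fy) (pmin _ Fz);
      rewrite -[a p <= a y]subr_ge0 -[a p <= a z]subr_ge0.
    rewrite -(subr_gt0 t) in t1; move=> py pz aC.
    have yp := mulr_ge0 (ltW t0) py; have zp := mulr_ge0 (ltW t1) pz.
    split; split=> //=; rewrite -subr_le0.
      by rewrite -(pmulr_rle0 _ t0); lra.
    by rewrite -(pmulr_rle0 _ t1); lra.
move=> cw; have [p pmin] := continuous_argmin cw.1.
have faceT : face setT by split; [exact: closedT|exists x0|].
have := face_argmin _ _ _ cw faceT I (fun q _ => pmin q).
move=> /minimal_face[F [faceF FM minF]].
have [clF [x Fx] exF] := faceF.
suff F1 y : F y -> y = x.
  exists x; last by move=> y; apply: le_trans (pmin y); have [] := FM _ Fx.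
  move=> t y z t01 C; have [Fy Fz] := exF _ _ _ _ t01 C Fx.
  by split; exact: F1.
move=> Fy; apply: contrapT => /sep[a ca]; apply.
have cF : compact F by apply: subclosed_compact cT _.
have [|q qF qmin] := compact_EVT_min _ cF (continuous_subspaceT ca.1).
  by exists x.
have qmin' r : F r -> a q <= a r by move=> Fr; apply: qmin; rewrite inE.
have Fq : F q by rewrite inE in qF.
have e : F `&` [set r | a r <= a q] = F.
  by apply: minF => [|r []//]; exact: face_argmin.
have aq r : F r -> a r = a q.
  move=> Fr; apply/eqP; rewrite eq_le qmin' // andbT.
  by move: Fr; rewrite -e => -[].
by rewrite !aq.
Qed.

End ContinuousConcave.

(** * Minimal sublinear functionals *)

Section MinimalFunctional.
Context (R : realType) (T : topologicalType).
Context (cmb : R -> T -> T -> T -> Prop).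
Context (cT : compact [set: T]) (phi : T).
Implicit Types (f g w : T -> R) (P : (T -> R) -> R -> Prop).
Implicit Type q : (T -> R) -> R.
Notation ccv := (ccv cmb).

(** The laws are imposed on continuous functions only, as q is defined on all of [T -> R]. Once q is
    linear, [dominated_ccv] for an affine a and for - a says that phi is the barycentre. *)
Record dominated q : Prop := Dominated {
  dominatedD : forall f g, continuous f -> continuous g ->
    q (f + g) <= q f + q g;
  dominatedZ : forall c f, 0 < c -> continuous f ->
    q (c \*o f) = c * q f;
  dominated_homo : forall f g, continuous f -> continuous g ->
    (forall x, f x <= g x) -> q f <= q g;
  dominated_reg : forall f e, continuous f -> 0 < e ->
    exists w, [/\ ccv w, forall x, f x <= w x & q w < q f + e];
  dominated_ccv : forall w, ccv w -> q w <= w phi }.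

Lemma dominated0 q : dominated q -> q 0 = 0.
Proof.
move=> dq; have c0 : continuous (0 : T -> R) := (ccv_cst cmb 0).1.
have := dominatedZ dq (ltr0Sn R 1) c0; rewrite (_ : _ \*o _ = 0); last first.
  by apply/funext => x /=; rewrite mulr0.
by lra.
Qed.

Lemma dominated_cst q c : dominated q -> q (cst c) = c.
Proof.
move=> dq; have := dominatedD dq (ccv_cst cmb c).1 (ccv_cst cmb (- c)).1.
rewrite (_ : cst c + _ = 0); last by apply/funext => x; rewrite !fctE subrr.
have := dominated_ccv dq (ccv_cst cmb c).
have := dominated_ccv dq (ccv_cst cmb (- c)) => /=.
by rewrite dominated0//; lra.
Qed.

Lemma dominated_ge q f m : dominated q -> continuous f ->
  (forall x, m <= f x) -> m <= q f.
Proof.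
move=> dq cf mf; rewrite -[leLHS](dominated_cst m dq).
by apply: dominated_homo => //; exact: (ccv_cst cmb m).1.
Qed.

(** P w v reads: v is an admissible upper value for w. A relation serves better than a function,
    since three choices occur: v = w phi, the values of a chain of functionals, and values depending
    on a parameter r >= 0; the infimum is taken once for all of them. *)
Definition upper_env P g : R :=
  inf [set v | exists w, [/\ ccv w, forall x, g x <= w x & P w v]].

Section UpperEnvelope.
Context (P : (T -> R) -> R -> Prop).
Hypothesis PD : forall w1 w2 v1 v2, ccv w1 -> ccv w2 -> P w1 v1 -> P w2 v2 ->
  P (w1 + w2) (v1 + v2).
Hypothesis PZ : forall c w v, 0 < c -> ccv w -> P w v -> P (c \*o w) (c * v).
Hypothesis Pge : forall w v m, ccv w -> P w v -> (forall x, m <= w x) -> m <= v.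
Hypothesis Pphi : forall w, ccv w -> exists2 v, P w v & v <= w phi.

Let E g := [set v | exists w, [/\ ccv w, forall x, g x <= w x & P w v]].

Let has_inf_E g : continuous g -> has_inf (E g).
Proof.
move=> cg; split.
  have [m gm] := continuous_ubound cT phi cg.
  have [v Pv _] := Pphi (ccv_cst cmb m).
  by exists v, (cst m); split=> //; exact: ccv_cst.
have [m gm] := continuous_lbound cT phi cg.
exists m => v [w [cw gw /Pge]]; apply=> // x.
exact: le_trans (gm x) (gw x).
Qed.

Lemma upper_env_le g w v : continuous g -> ccv w -> (forall x, g x <= w x) ->
  P w v -> upper_env P g <= v.
Proof. by move=> /has_inf_E[_ lE] cw gw Pv; apply: ge_inf => //; exists w. Qed.

Lemma upper_env_adherent g e : continuous g -> 0 < e ->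
  exists w v, [/\ ccv w, forall x, g x <= w x, P w v & v < upper_env P g + e].
Proof.
by move=> /has_inf_E iE e0; have [v [w [? ? ?]] ?] := inf_adherent e0 iE;
  exists w, v.
Qed.

(** Regularity holds by construction: an almost optimal w for f is its own competitor, so its
    envelope is at most v. For homogeneity one inequality suffices, applied to c and to 1/c. *)
Lemma dominated_upper_env : dominated (upper_env P).
Proof.
have envZ c f : 0 < c -> continuous f ->
    upper_env P (c \*o f) <= c * upper_env P f.
  move=> c0 cf; apply/ler_addgt0Pr => e e0.
  have [w [v [cw fw Pv ve]]] := upper_env_adherent cf (divr_gt0 e0 c0).
  rewrite -[e in leRHS](divfK (lt0r_neq0 c0)) [e / c * c]mulrC -mulrDr.
  apply: (@le_trans _ _ (c * v)); last by rewrite ler_pM2l// ltW.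
  apply: upper_env_le (PZ c0 cw Pv); first exact: continuous_fctZ.
    exact: ccvZ (ltW c0) cw.
  by move=> x /=; rewrite ler_pM2l.
split.
- move=> f g cf cg; apply/ler_addgt0Pr => e e0.
  have e20 : 0 < e / 2 by rewrite divr_gt0.
  have [wf [vf [? fw ? vfe]]] := upper_env_adherent cf e20.
  have [wg [vg [? gw ? vge]]] := upper_env_adherent cg e20.
  apply: (@le_trans _ _ (vf + vg)); last by lra.
  apply: (@upper_env_le _ (wf + wg)); [exact: continuous_fctD|exact: ccvD| |].
    by move=> x; rewrite !fctE lerD.
  exact: PD.
- move=> c f c0 cf; apply/eqP; rewrite eq_le envZ//=.
  rewrite -ler_pdivlMl//.
  have {1}-> : f = c^-1 \*o (c \*o f).
    by apply/funext => x /=; rewrite mulKf// lt0r_neq0.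
  by apply: envZ; rewrite ?invr_gt0//; exact: continuous_fctZ.
- move=> f g cf cg fg; apply/ler_addgt0Pr => e e0.
  have [w [v [cw gw Pv ve]]] := upper_env_adherent cg e0.
  apply: (@le_trans _ _ v); last exact: ltW.
  by apply: (@upper_env_le _ w) => // x; exact: le_trans (fg x) (gw x).
- move=> f e cf e0; have [w [v [cw fw Pv ve]]] := upper_env_adherent cf e0.
  exists w; split=> //; apply: le_lt_trans ve.
  by apply: (@upper_env_le _ w) => //; exact: cw.1.
- move=> w cw; have [v Pv vw] := Pphi cw; apply: le_trans vw.
  by apply: (@upper_env_le _ w) => //; exact: cw.1.
Qed.

End UpperEnvelope.

Lemma minimal_dominated : exists q, dominated q /\
  forall q', dominated q' -> (forall f, continuous f -> q' f <= q f) ->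
    forall f, continuous f -> q f <= q' f.
Proof.
(* The start is the upper concave envelope evaluated at phi. *)
have d0 : dominated (upper_env (fun w v => v = w phi)).
  apply: dominated_upper_env => [w1 w2 _ _ _ _ -> ->|c w _ _ _ -> |w v m _ ->
    |w _]//.
  by exists (w phi).
pose D := {q | dominated q}.
(* The order is reversed: maximal for [r] means minimal as a functional. *)
pose r (s t : D) := `[< forall f, continuous f -> sval t f <= sval s f >].
have [|||[q dq] qmin] := @ZL_preorder D (exist _ _ d0) r.
- by move=> s; apply/asboolP.
- move=> s t u /asboolP st /asboolP tu; apply/asboolP => f cf.
  exact: le_trans (tu _ cf) (st _ cf).
- move=> A totA.
  have [[s0 As0]|nA] := pselect (A !=set0); last first.
    by exists (exist _ _ d0) => s As; exfalso; apply: nA; exists s.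
  (* A chain is bounded below by the envelope of its pointwise infima on concave functions. Totality
     serves subadditivity: the smaller of two functionals works for both summands. *)
  pose P w v := exists2 s, A s & sval s w <= v.
  have Pge w v m : ccv w -> P w v -> (forall x, m <= w x) -> m <= v.
    move=> [cw _] [s As sv] mw; apply: le_trans sv.
    exact: dominated_ge (svalP s) cw mw.
  have Pphi w : ccv w -> exists2 v, P w v & v <= w phi.
    move=> cw; exists (sval s0 w); first by exists s0.
    exact: dominated_ccv (svalP s0) _ cw.
  have dP : dominated (upper_env P).
    apply: dominated_upper_env => //.
      move=> w1 w2 v1 v2 [c1 _] [c2 _] [s1 As1 s1v] [s2 As2 s2v].
      have [/asboolP s12|/asboolP s21] := totA _ _ As1 As2.
        exists s2 => //; apply: (le_trans (dominatedD (svalP s2) c1 c2)).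
        by rewrite lerD//; exact: le_trans (s12 _ c1) s1v.
      exists s1 => //; apply: (le_trans (dominatedD (svalP s1) c1 c2)).
      by rewrite lerD//; exact: le_trans (s21 _ c2) s2v.
    move=> c w v c0 [cw _] [s As sv]; exists s => //.
    by rewrite (dominatedZ (svalP s))// ler_pM2l.
  exists (exist _ _ dP) => s As; apply/asboolP => f cf /=.
  apply/ler_addgt0Pr => e e0.
  have [w [cw fw we]] := dominated_reg (svalP s) cf e0.
  apply: le_trans (ltW we); apply: (upper_env_le Pge Pphi cf cw fw).
  by exists s.
exists q; split=> // q' dq' q'q.
have /(qmin (exist _ _ dq'))/asboolP// : r (exist _ _ dq) (exist _ _ dq').
exact/asboolP.
Qed.

(* For a minimal q and a fixed f, the functional
   w |-> inf_(r >= 0) q (w + r f) - r q f is again dominated and is below q,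
   hence equal to q: this is additivity of q between w and f. *)
Lemma additive_dominated : exists q, dominated q /\
  forall w f, ccv w -> continuous f -> q (w + f) = q w + q f.
Proof.
have [q [dq minq]] := minimal_dominated.
exists q; split=> // w f cw cf.
apply/eqP; rewrite eq_le (dominatedD dq cw.1 cf)/=.
pose P w v := exists2 r, 0 <= r & q (w + r \*o f) - r * q f <= v.
have crf r : continuous (r \*o f) by exact: continuous_fctZ.
have qZ r : 0 <= r -> q (r \*o f) = r * q f.
  rewrite le_eqVlt => /orP[/eqP<-|r0]; last exact: dominatedZ.
  rewrite mul0r -[RHS](dominated0 dq); congr q.
  by apply/funext => x /=; rewrite mul0r.
have P0 w1 : P w1 (q w1).
  exists 0 => //; rewrite mul0r subr0 (_ : _ + _ = w1)//.
  by apply/funext => x; rewrite !fctE/= mul0r addr0.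
have Pge w1 v m : ccv w1 -> P w1 v -> (forall x, m <= w1 x) -> m <= v.
  move=> cw1 [r r0 rv] mw; apply: le_trans rv.
  have cm : continuous (cst (- m) : T -> R) := (ccv_cst cmb (- m)).1.
  have := dominatedD dq (continuous_fctD cw1.1 (crf r)) cm.
  rewrite (dominated_cst _ dq) -(qZ _ r0).
  (* Since r f <= w1 + r f - m, the term r q f cancels and the lower bound m does not depend on
     r. *)
  have : q (r \*o f) <= q (w1 + r \*o f + cst (- m)).
    apply: (dominated_homo dq) => //.
      by apply: continuous_fctD => //; apply: continuous_fctD => //;
        exact: cw1.1.
    by move=> x; rewrite !fctE/=; have := mw x; lra.
  lra.
have Pphi w1 : ccv w1 -> exists2 v, P w1 v & v <= w1 phi.
  by move=> cw1; exists (q w1) => //; exact: dominated_ccv.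
have dP : dominated (upper_env P).
  apply: dominated_upper_env => // [w1 w2 v1 v2 [c1 _] [c2 _]|c w1 v c0 [c1 _]].
    move=> [r1 r10 r1v] [r2 r20 r2v]; exists (r1 + r2); first exact: addr_ge0.
    apply: le_trans (lerD r1v r2v).
    have := dominatedD dq (continuous_fctD c1 (crf r1)) (continuous_fctD c2
      (crf r2)).
    rewrite (_ : w1 + _ + _ = w1 + w2 + (r1 + r2) \*o f); first by lra.
    by apply/funext => x; rewrite !fctE/=; lra.
  move=> [r r0 rv]; exists (c * r); first by rewrite mulr_ge0// ltW.
  rewrite (_ : _ + _ = c \*o (w1 + r \*o f)); last first.
    by apply/funext => x; rewrite !fctE/= mulrDr mulrA.
  rewrite (dominatedZ dq c0); last exact: continuous_fctD.
  by rewrite -mulrA -mulrBr ler_pM2l.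
(* The value r = 0 puts the new functional below q, so minimality applies; the value r = 1 then
   yields the missing inequality. *)
have : q w <= upper_env P w.
  apply: minq dP _ _ cw.1 => g cg; apply/ler_addgt0Pr => e e0.
  have [w1 [cw1 gw we]] := dominated_reg dq cg e0.
  by apply: le_trans (ltW we); exact: (upper_env_le Pge Pphi cg cw1 gw).
have : upper_env P w <= q (w + f) - q f.
  apply: (upper_env_le Pge Pphi cw.1 cw) => //.
  exists 1 => //; rewrite mul1r (_ : 1 \*o f = f)//.
  by apply/funext => x /=; rewrite mul1r.
lra.
Qed.

End MinimalFunctional.

(** * Simons' inequality *)

Lemma halfX_lt (R : realType) (M e : R) :
  0 < e -> exists n, 2^-1 ^+ n * M < e.
Proof.
move=> e0; exists (Num.bound (M / e)); rewrite exprVn mulrC.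
rewrite ltr_pdivrMr ?exprn_gt0// mulrC -ltr_pdivrMr//.
exact: Num.Theory.upper_nthrootP.
Qed.

Lemma le_halfX (R : realType) (M a b : R) :
  (forall n, a <= b + 2^-1 ^+ n * M) -> a <= b.
Proof.
move=> ab; apply/ler_addgt0Pr => e e0; have [n nM] := halfX_lt M e0.
by apply: le_trans (ab n) _; rewrite lerD2l ltW.
Qed.

(** * Dyadic series of uniformly bounded nonpositive functions *)

Section HalfSeries.
Context (R : realType) (T : Type).
Implicit Types (g : nat -> T -> R) (n : nat) (x : T).

(** This is the sum of 2^-(k+1) g k over k < n in Horner form. Shifting the sequence makes each step
    an average of two functions, so convexity properties follow by induction. *)
Fixpoint half_sum n g : T -> R :=
  if n is n'.+1 then 2^-1 \*o (g 0%N + half_sum n' (g \o succn)) else cst 0.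

(** For g <= 0 the partial sums decrease, so their infimum is their limit; the two-sided estimate
    [half_series_bound] then replaces limit arguments. *)
Definition half_series g : T -> R := fun x => inf (range (half_sum ^~ g ^~ x)).

Context (M : R).
Let bd g := forall k x, - M <= g k x <= 0.

Let bdS g : bd g -> bd (g \o succn). Proof. by move=> bg k x; exact: bg. Qed.

Lemma half_sum_bound g n x : bd g -> - M <= half_sum n g x <= 0.
Proof.
elim: n g => [|n IH] g bg /=.
  by rewrite lexx andbT; have := bg 0%N x; rewrite ?fctE; lra.
by have := IH _ (bdS bg); have := bg 0%N x; rewrite ?fctE/=; lra.
Qed.

Lemma half_sum_tail g n k x : bd g ->
  half_sum n g x - 2^-1 ^+ n * M <= half_sum (n + k) g x <= half_sum n g x.
Proof.
elim: n g => [|n IH] g bg.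
  by have := half_sum_bound k x bg; rewrite add0n expr0 mul1r sub0r.
rewrite addSn /=; have := IH _ (bdS bg).
by rewrite ?fctE/= exprS; lra.
Qed.

Lemma half_series_bound g n x : bd g ->
  half_sum n g x - 2^-1 ^+ n * M <= half_series g x <= half_sum n g x.
Proof.
move=> bg; apply/andP; split; last first.
  apply: ge_inf; last by exists n.
  by exists (- M) => _ [k _ <-]; case/andP: (half_sum_bound k x bg).
apply: lb_le_inf; first by exists (half_sum 0 g x), 0%N.
move=> _ [k _ <-]; have [nk|kn] := leqP n k.
  by rewrite -(subnKC nk); case/andP: (half_sum_tail n (k - n) x bg).
have := half_sum_tail k (n - k) x bg; rewrite (subnKC (ltnW kn)).
have : 0 <= 2^-1 ^+ n * M.
  rewrite mulr_ge0 ?exprn_ge0 ?invr_ge0//.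
  by have := bg 0%N x; lra.
by lra.
Qed.

Lemma half_seriesE g x : bd g ->
  half_series g x = 2^-1 * (g 0%N x + half_series (g \o succn) x).
Proof.
move=> bg; apply/eqP; rewrite eq_le; apply/andP.
split; apply: (@le_halfX _ M) => n.
  have := half_series_bound n x (bdS bg).
  have := half_series_bound n.+1 x bg.
  have : 0 <= 2^-1 ^+ n * M.
    rewrite mulr_ge0 ?exprn_ge0 ?invr_ge0//; have := bg 0%N x; lra.
  by rewrite /= ?fctE/= exprS; lra.
have := half_series_bound n x (bdS bg).
have := half_series_bound n.+1 x bg.
have : 0 <= 2^-1 ^+ n * M.
  rewrite mulr_ge0 ?exprn_ge0 ?invr_ge0//; have := bg 0%N x; lra.
by rewrite /= ?fctE/= exprS; lra.
Qed.

End HalfSeries.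

Lemma continuous_uniform_approx (R : realType) (T : topologicalType)
    (f : T -> R) :
  (forall e, 0 < e -> exists2 g : T -> R, continuous g &
     forall x, `|f x - g x| <= e) -> continuous f.
Proof.
move=> fg x; apply/cvgrPdist_lt => e e0.
have e30 : 0 < e / 3 by rewrite divr_gt0.
have [g cg gf] := fg _ e30.
have /cvgrPdist_lt/(_ _ e30) := cg x.
apply: filterS => y gxy.
have := gf x; have := gf y; move: gxy.
move: (f x) (f y) (g x) (g y) => fx fy gx gy.
by rewrite !ltr_norml !ler_norml => *; lra.
Qed.

Section Simons.
Context (R : realType) (T : topologicalType).
Context (cmb : R -> T -> T -> T -> Prop).
Context (cT : compact [set: T]) (phi : T).
Notation ccv := (ccv cmb).
Context (sep : forall x y, x <> y -> exists2 w : T -> R, ccv w & w x <> w y).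
Context (q : (T -> R) -> R) (dq : dominated cmb phi q).

Lemma half_sum_ccv (g : nat -> T -> R) n :
  (forall k, ccv (g k)) -> ccv (half_sum n g).
Proof.
elim: n g => [|n IH] g cg /=; first exact: (ccv_cst cmb 0).
by apply: ccvZ; rewrite ?invr_ge0//; apply: ccvD => //; apply: IH => k;
  exact: cg.
Qed.

Section Slab.
Context (u : T -> R) (a M : R).

Definition slab : set (T -> R) :=
  [set w | [/\ ccv w, forall x, u x <= w x, forall x, w x <= 0 & q w <= a]].

Context (uM : forall x, - M <= u x).

(** The weights used so far add up to 1 - 2^-n; the remaining weight sits on the zero function,
    which also lies above u. *)
Lemma half_sum_slab (g : nat -> T -> R) n : (forall k, slab (g k)) ->
  (forall x, u x <= half_sum n g x) /\
  q (half_sum n g) <= (1 - 2^-1 ^+ n) * a.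
Proof.
elim: n g => [|n IH] g sg /=.
  rewrite expr0 subrr mul0r (dominated_cst _ dq); split=> // x.
  by have [_ h1 h2 _] := sg 0%N; exact: le_trans (h1 x) (h2 x).
have [h1 h2] := IH _ (fun k => sg k.+1); have [c0 ug _ qg] := sg 0%N.
have ch : ccv (half_sum n (g \o succn)).
  by apply: half_sum_ccv => k; have [] := sg k.+1.
split=> [x|].
  by rewrite ?fctE; have := h1 x; have := ug x => /=; lra.
rewrite (dominatedZ dq) ?invr_gt0//; last by apply: continuous_fctD;
  [exact: c0.1|exact: ch.1].
have := dominatedD dq c0.1 ch.1; rewrite exprS; lra.
Qed.

(** Countable convexity of the slab. Monotonicity and finite subadditivity of q suffice: the series
    lies below each of its partial sums, whose q-values are at most (1 - 2^-n) a. *)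
Lemma half_series_slab (g : nat -> T -> R) : (forall k, slab (g k)) ->
  slab (half_series g).
Proof.
move=> sg.
have bg k x : - M <= g k x <= 0.
  have [_ ug -> _] := sg k; rewrite andbT; exact: le_trans (uM x) (ug x).
have hb n x := half_series_bound n x bg.
have cg n : ccv (half_sum n g) by apply: half_sum_ccv => k; have [] := sg k.
have ch : continuous (half_series g).
  apply: continuous_uniform_approx => e e0; have [n nM] := halfX_lt M e0.
  exists (half_sum n g); first exact: (cg n).1.
  by move=> x; rewrite ler_norml; have := hb n x; lra.
split.
- split=> // t y z x /andP[t0 t1] C; apply: (@le_halfX _ M) => n.
  have := (cg n).2 _ _ _ _ _ C; rewrite t0 t1 => /(_ isT).
  have /andP[_ hy] := hb n y; have /andP[_ hz] := hb n z.
  have /andP[hx _] := hb n x.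
  have : t * half_series g y <= t * half_sum n g y by rewrite ler_pM2l.
  have : (1 - t) * half_series g z <= (1 - t) * half_sum n g z.
    by rewrite ler_pM2l ?subr_gt0.
  lra.
- move=> x; apply: (@le_halfX _ M) => n.
  by have [/(_ x) + _] := half_sum_slab n sg; have := hb n x; lra.
- by move=> x; have := hb 0%N x => /andP[].
- apply: (@le_halfX _ (- a)) => n; have [_] := half_sum_slab n sg.
  have : q (half_series g) <= q (half_sum n g).
    by apply: (dominated_homo dq) => // [|x];
      [exact: (cg n).1|case/andP: (hb n x)].
  lra.
Qed.

End Slab.

(* Simons' argument: if all the convex sets [slab (u n) (-e)] were nonempty, a
   series of almost optimal choices would attain its minimum at an extreme
   point where u does not tend to 0. *)
Lemma simons (u : nat -> T -> R) :
  (forall n, continuous (u n)) -> (forall n x, u n x <= 0) ->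
  (forall n x, u n x <= u n.+1 x) ->
  (forall x, ext_points cmb x -> forall e, 0 < e -> exists n, - e < u n x) ->
  forall e, 0 < e -> exists n, - e <= q (u n).
Proof.
move=> cu u0 uS uext e e0; apply: contrapT => nq.
have {nq}qu n : q (u n) < - e.
  by rewrite ltNge; apply/negP => qun; apply: nq; exists n.
pose C n := slab (u n) (- e).
have Cne n : C n !=set0.
  have e'0 : 0 < - e - q (u n) by have := qu n; lra.
  have [w [cw uw qw]] := dominated_reg dq (cu n) e'0.
  (* Truncating the concave majorant at 0 keeps it above [u n], because [u n] <= 0. *)
  exists (w \min cst 0); split.
  - exact: ccv_min cw (ccv_cst cmb 0).
  - by move=> x /=; rewrite le_min uw u0.
  - by move=> x /=; rewrite ge_min lexx orbT.
  - apply: (@le_trans _ _ (q w)); last by lra.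
    apply: (dominated_homo dq); [|exact: cw.1|].
      exact: (ccv_min cw (ccv_cst cmb 0)).1.
    by move=> x /=; rewrite ge_min lexx.
have umono m n x : (m <= n)%N -> u m x <= u n x.
  by move=> /subnKC <-; elim: (n - m)%N => [|k IH];
    rewrite ?addn0// addnS (le_trans IH).
have CS m n w : (m <= n)%N -> C n w -> C m w.
  by move=> mn [cw uw w0 qw]; split=> // x;
    exact: le_trans (umono _ _ x mn) (uw x).
have [M uM] : exists M, forall n x, - M <= u n x.
  have [m mu] := continuous_lbound cT phi (cu 0%N).
  by exists (- m) => n x; rewrite opprK;
    exact: le_trans (mu x) (umono _ _ x (leq0n n)).
pose mn (f : T -> R) := inf (range f).
have mn_le f x : continuous f -> mn f <= f x.
  move=> cf; apply: ge_inf; last by exists x.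
  have [m mf] := continuous_lbound cT phi cf.
  by exists m => _ [y _ <-].
have le_mn f m : (forall x, m <= f x) -> m <= mn f.
  by move=> mf; apply: lb_le_inf; [exists (f phi), phi|move=> _ [y _ <-]].
(* The errors hp n * d at the minimum point b add up to at most 2 d = e / 2, which leaves G n b < -
   e / 2. *)
pose d := e / 4.
have d0 : 0 < d by rewrite divr_gt0.
pose hp n : R := 2^-1 ^+ n.
have hp0 n : 0 < hp n by rewrite exprn_gt0 ?invr_gt0.
(* g is chosen almost optimally as if it received all of the weight 2^-n still to be distributed.
   One factor hp n of the error is lost when this weight is divided out; the other makes the errors
   summable. *)
have nearly n (h : T -> R) : continuous h -> exists2 g, C n.+1 g &
    forall g', C n.+1 g' ->
      mn (h + hp n \*o g') <= mn (h + hp n \*o g) + hp n * hp n * d.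
  move=> ch; pose V := [set mn (h + hp n \*o g) | g in C n.+1].
  have sV : has_sup V.
    split; first by have [g Cg] := Cne n.+1; exists (mn (h + hp n \*o g)), g.
    exists (h phi) => _ [g [cg _ g0 _] <-].
    apply: (@le_trans _ _ ((h + hp n \*o g) phi)).
      by apply: mn_le; apply: continuous_fctD => //; apply: continuous_fctZ;
        exact: cg.1.
    by rewrite ?fctE /= gerDl pmulr_rle0.
  have hd : 0 < hp n * hp n * d by rewrite !mulr_gt0.
  have [_ [g Cg <-] gsup] := sup_adherent hd sV.
  exists g => // g' Cg'; rewrite -lerBlDr; apply: le_trans (ltW gsup).
  by rewrite lerD2r; apply: ub_le_sup; [exact: sV.2|exists g'].
(* A discontinuous h gets a dummy value; [FP] concerns continuous h only. *)
pose F n h := if pselect (continuous h) is left ch then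
    sval (cid2 (nearly n h ch)) else h.
pose h := fix h n := if n is n'.+1 then h n' + hp n'.+1 \*o F n' (h n') else
  cst 0 : T -> R.
have FP n f : continuous f -> C n.+1 (F n f) /\ forall g', C n.+1 g' ->
    mn (f + hp n \*o g') <= mn (f + hp n \*o F n f) + hp n * hp n * d.
  move=> cf; rewrite /F; case: pselect => // ch.
  by case: cid2.
have chn n : continuous (h n).
  elim: n => [|n IH] /=; first exact: (ccv_cst cmb 0).1.
  have [[cF _ _ _] _] := FP n _ IH.
  by apply: continuous_fctD => //; apply: continuous_fctZ; exact: cF.1.
pose g n := F n (h n).
have Cg n : C n.+1 (g n) by have [] := FP n _ (chn n).
pose G n := half_series (fun k => g (n + k)%N).
have CG n : C n.+1 (G n).
  apply: (half_series_slab (uM n.+1)) => k.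
  by apply: CS (Cg _); rewrite ltnS leq_addr.
have GE n x : G n x = 2^-1 * (g n x + G n.+1 x).
  rewrite /G (half_seriesE (M := M)).
    have -> : (fun k => g (n + k)%N) \o succn = fun k => g (n.+1 + k)%N.
      by apply/funext => k; rewrite /= addnS addSn.
    by rewrite addn0.
  move=> k y; have [_ ug -> _] := Cg (n + k)%N; rewrite andbT.
  exact: le_trans (uM _ y) (ug y).
have hG n x : G 0%N x = h n x + hp n * G n x.
  elim: n => [|n ->]; first by rewrite /= /hp expr0 mul1r add0r.
  by rewrite /= ?fctE/= -/(g n) [in LHS]GE /hp exprS; lra.
have [b extb bmin] := bauer_min cT phi sep (let: And4 c _ _ _ := CG 0%N in c).
have G0b : G 0%N b <= - e.
  have [c _ _ qG] := CG 0%N; apply: le_trans qG.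
  exact: dominated_ge dq c.1 bmin.
(* The tail G n is itself a competitor in the choice of g n, and h n + hp n G n = G 0 is minimal at
   b. Hence G n b <= g n b + hp n d, and G n = (g n + G (n+1)) / 2 turns this into the claim. *)
have step n : G n.+1 b <= G n b + hp n * d.
  have cgn : continuous (h n + hp n \*o g n).
    have [c _ _ _] := Cg n.
    by apply: continuous_fctD => //; apply: continuous_fctZ; exact: c.1.
  have gb : mn (h n + hp n \*o g n) <= h n b + hp n * g n b.
    exact: (mn_le _ b cgn).
  have opt : G 0%N b <= mn (h n + hp n \*o g n) + hp n * hp n * d.
    have [_ /(_ _ (CG n)) opt] := FP n _ (chn n).
    apply: le_trans opt; apply: le_mn => x.
    by have := bmin x; rewrite (hG n x).
  have : hp n * G n b <= hp n * (g n b + hp n * d).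
    have := le_trans opt (lerD gb (lexx _)).
    rewrite (hG n b) mulrDr [hp n * (hp n * d)]mulrA -addrA.
    by rewrite lerD2l.
  rewrite ler_pM2l//; have := GE n b.
  by move: (G n b) (G n.+1 b) (g n b) (hp n * d) => *; lra.
have Gb n : G n b <= - e + (1 - hp n) * 2 * d.
  elim: n => [|n IH]; first by rewrite /hp expr0 subrr !mul0r addr0.
  apply: le_trans (step n) _; move: IH.
  have -> : hp n = 2 * hp n.+1 by rewrite /hp exprS mulrA divff ?mul1r.
  by move: (G n b) (hp n.+1) => *; lra.
have e20 : 0 < e / 2 by rewrite divr_gt0.
have [n un] := uext b extb _ e20.
have uG : u n b <= G n b.
  by have [_ uG _ _] := CG n; exact: le_trans (uS _ _) (uG b).
have := Gb n; have : 0 < hp n * d by rewrite mulr_gt0.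
move: (lt_le_trans un uG); rewrite /d.
by move: (hp n) (G n b) => *; lra.
Qed.

End Simons.

(** * The Daniell outer measure *)

Record vlattice (R : realType) (T : Type) (V : set (T -> R)) : Prop :=
  VLattice {
  vlatticeD : forall f g, V f -> V g -> V (f + g);
  vlatticeZ : forall c f, V f -> V (c \*o f);
  vlattice_cst : forall c, V (cst c);
  vlattice_min : forall f g, V f -> V g -> V (f \min g) }.

(** No continuity along sequences is included; Daniell's condition enters separately, as the
    hypothesis [daniell]. *)
Record unital_positive (R : realType) (T : Type) (V : set (T -> R))
    (lam : (T -> R) -> R) : Prop := UnitalPositive {
  positiveD : forall f g, V f -> V g -> lam (f + g) = lam f + lam g;
  positiveZ : forall c f, V f -> lam (c \*o f) = c * lam f;
  positive_homo : forall f g, V f -> V g -> (forall x, f x <= g x) ->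
    lam f <= lam g;
  positive_cst : forall c, lam (cst c) = c }.

Lemma vlatticeB (R : realType) (T : Type) (V : set (T -> R)) f g :
  vlattice V -> V f -> V g -> V (f - g).
Proof.
move=> vV Vf Vg; rewrite (_ : f - g = f + (-1 \*o g)).
  by apply: vlatticeD => //; exact: vlatticeZ.
by apply/funext => x; rewrite !fctE/=; lra.
Qed.

Lemma positiveB (R : realType) (T : Type) (V : set (T -> R)) lam f g :
  vlattice V -> unital_positive V lam -> V f -> V g ->
  lam (f - g) = lam f - lam g.
Proof.
move=> vV pl Vf Vg; rewrite (_ : f - g = f + (-1 \*o g)).
  by rewrite (positiveD pl)// ?(positiveZ pl)// ?mulN1r//; exact: vlatticeZ.
by apply/funext => x; rewrite !fctE/=; lra.
Qed.

Section Daniell.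
Context (R : realType) (T : Type) (V : set (T -> R)) (lam : (T -> R) -> R).
Context (vV : vlattice V) (pl : unital_positive V lam) (X : set T).
Implicit Types (f g : T -> R) (F : nat -> T -> R) (A B : set T).

(* Covering is tested on X only: sets disjoint from X get outer measure 0. *)
Record cover B F : Prop := Cover {
  cover_mem : forall n, V (F n);
  cover_ge0 : forall n x, 0 <= F n x;
  cover_le1 : forall n x, F n x <= 1;
  cover_homo : forall m n x, (m <= n)%N -> F m x <= F n x;
  cover_sup : forall x, B x -> X x -> forall e, 0 < e ->
    exists n, 1 - e < F n x }.

Definition upper_sums B : set R :=
  [set r | exists2 F, cover B F & forall n, lam (F n) <= r].

Definition daniell_outer B : \bar R := ereal_inf (EFin @` upper_sums B).

Let lam_cover B F m n : cover B F -> (m <= n)%N -> lam (F m) <= lam (F n).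
Proof.
by move=> cF mn; apply: (positive_homo pl) => [||x];
  [exact: cover_mem cF _..|exact: cover_homo cF _ _ _ mn].
Qed.

Lemma cover_cst g B : V g -> (forall x, 0 <= g x <= 1) ->
  (forall x, B x -> 1 <= g x) -> cover B (fun=> g).
Proof.
move=> Vg g01 Bg; split=> //.
- by move=> _ x; case/andP: (g01 x).
- by move=> _ x; case/andP: (g01 x).
- by move=> x /Bg gx _ e e0; exists 0%N; lra.
Qed.

Lemma upper_sums_ge0 B r : upper_sums B r -> 0 <= r.
Proof.
move=> [F cF Fr]; apply: le_trans (Fr 0%N); rewrite -(positive_cst pl 0).
apply: (positive_homo pl); [exact: vlattice_cst|exact: cover_mem cF _|].
by move=> x; exact: cover_ge0 cF _ _.
Qed.

Lemma daniell_outer_le B r : upper_sums B r -> (daniell_outer B <= r%:E)%E.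
Proof. by move=> Br; apply: ereal_inf_lbound; exists r. Qed.

Lemma daniell_outer_le_lam g B : V g -> (forall x, 0 <= g x <= 1) ->
  (forall x, B x -> 1 <= g x) -> (daniell_outer B <= (lam g)%:E)%E.
Proof.
by move=> Vg g01 Bg; apply: daniell_outer_le; exists (fun=> g) => //;
  exact: cover_cst.
Qed.

Lemma daniell_outer_ge0 B : (0 <= daniell_outer B)%E.
Proof.
by apply: le_ereal_inf_tmp => _ [r Br <-]; rewrite lee_fin;
  exact: upper_sums_ge0 Br.
Qed.

Lemma daniell_outer_le1 B : (daniell_outer B <= 1)%E.
Proof.
rewrite -(positive_cst pl 1); apply: daniell_outer_le_lam => //=.
- exact: vlattice_cst.
- by move=> x; rewrite ler01 lexx.
Qed.

Lemma daniell_outer_disjoint B : B `&` X = set0 -> daniell_outer B = 0%E.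
Proof.
move=> BX; apply/eqP; rewrite eq_le daniell_outer_ge0 andbT.
apply: daniell_outer_le; exists (fun=> cst 0) => [|_];
  last by rewrite (positive_cst pl).
split=> //=; first by move=> _; exact: vlattice_cst.
by move=> x Bx Xx; exfalso; have : set0 x by rewrite -BX.
Qed.

Lemma daniell_outer0 : daniell_outer set0 = 0%E.
Proof. by apply: daniell_outer_disjoint; rewrite set0I. Qed.

Lemma le_daniell_outer : {homo daniell_outer : A B / A `<=` B >-> (A <= B)%E}.
Proof.
move=> A B AB; apply: le_ereal_inf => _ [r [F cF Fr] <-].
exists r => //; exists F => //; split; try by case: cF.
by move=> x /AB; exact: cover_sup cF x.
Qed.

Let V_sum F n : (forall k, V (F k)) -> V (fun x => \sum_(k < n) F k x).
Proof.
move=> VF; elim: n => [|n IH].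
  rewrite (_ : (fun _ => _) = cst 0); first exact: vlattice_cst.
  by apply/funext => x; rewrite big_ord0.
rewrite (_ : (fun _ => _) = (fun x => \sum_(k < n) F k x) + F n).
  exact: vlatticeD.
by apply/funext => x; rewrite big_ord_recr.
Qed.

Let lam_sum F n : (forall k, V (F k)) ->
  lam (fun x => \sum_(k < n) F k x) = \sum_(k < n) lam (F k).
Proof.
move=> VF; elim: n => [|n IH].
  rewrite big_ord0 -[RHS](positive_cst pl 0); congr lam.
  by apply/funext => x; rewrite big_ord0.
rewrite big_ord_recr/= -IH -(positiveD pl)//; last exact: V_sum.
by congr lam; apply/funext => x; rewrite big_ord_recr.
Qed.

(** The diagonal min(1, sum of F k n over k <= n) covers the union: it is a finite sum for each n,
    and it increases with n both through its terms and through their number. *)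
Lemma daniell_outer_sigma_subadditive : sigma_subadditive daniell_outer.
Proof.
move=> B; apply/lee_addgt0Pr => e e0.
apply: le_trans (epsilon_trick xpredT (fun n => daniell_outer_ge0 (B n)) (ltW
  e0)).
have eps n : 0 < e / (2 ^ n.+1)%:R by rewrite divr_gt0// ltr0n expn_gt0.
have /choice[r rP] n : exists r, upper_sums (B n) r /\
    (r%:E <= daniell_outer (B n) + (e / (2 ^ n.+1)%:R)%:E)%E.
  have fB : daniell_outer (B n) \is a fin_num.
    rewrite ge0_fin_numE ?daniell_outer_ge0//.
    exact: le_lt_trans (daniell_outer_le1 _) (ltry _).
  have [_ [r Br <-] rB] := lb_ereal_inf_adherent (eps n) fB.
  by exists r; split=> //; exact: ltW.
have /choice[F FP] n : exists F, cover (B n) F /\ forall k, lam (F k) <= r n.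
  by have [[F ? ?] _] := rP n; exists F.
pose G n := (cst 1) \min (fun x => \sum_(k < n.+1) F k n x).
have FG k n x : (k <= n)%N -> F k n x <= \sum_(k < n.+1) F k n x.
  move=> kn; rewrite (bigD1 (inord k))//= inordK ?ltnS// lerDl.
  by apply: sumr_ge0 => i _; exact: cover_ge0 (FP i).1 _ _.
have cG : cover (\bigcup_n B n) G.
  split.
  - move=> n; apply: vlattice_min => //; first exact: vlattice_cst.
    by apply: (@V_sum (F ^~ n)) => k; exact: cover_mem (FP k).1 _.
  - move=> n x; rewrite /G/= le_min ler01/=.
    by apply: sumr_ge0 => i _; exact: cover_ge0 (FP i).1 _ _.
  - by move=> n x; rewrite /G/= ge_min lexx.
  - move=> m n x mn; rewrite /G/= le_min ge_min lexx/=.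
    rewrite ge_min; apply/orP; right.
    apply: (@le_trans _ _ (\sum_(k < m.+1) F k n x)).
      by apply: ler_sum => k _; exact: cover_homo (FP k).1 _ _ _ mn.
    rewrite -(subnKC mn) -addSn -(big_mkord xpredT (fun k => F k _ x)).
    rewrite -(big_mkord xpredT (fun k => F k _ x)).
    rewrite [leRHS](@big_cat_nat _ _ _ m.+1)//= ?leq_addr// lerDl.
    by apply: sumr_ge0 => i _; exact: cover_ge0 (FP i).1 _ _.
  - move=> x [k _ Bx] Xx d d0.
    have [n xn] := cover_sup (FP k).1 Bx Xx d0.
    exists (maxn k n); rewrite /G/= lt_min; apply/andP; split; first by lra.
    apply: lt_le_trans xn _; apply: le_trans (FG k _ x (leq_maxl _ _)).
    exact: cover_homo (FP k).1 _ _ _ (leq_maxr _ _).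
have Gs n : ((lam (G n))%:E <=
    \sum_(k <oo) (daniell_outer (B k) + (e / (2 ^ k.+1)%:R)%:E))%E.
  apply: (@le_trans _ _ (\sum_(0 <= k < n.+1) (r k)%:E)%E).
    rewrite sumEFin lee_fin big_mkord.
    apply: (@le_trans _ _ (\sum_(k < n.+1) lam (F k n))).
      rewrite -(@lam_sum (F ^~ n)); last by move=> k;
        exact: cover_mem (FP k).1 _.
      apply: (positive_homo pl).
      - exact: cover_mem cG _.
      - by apply: (@V_sum (F ^~ n)) => k; exact: cover_mem (FP k).1 _.
      - by move=> x; rewrite /G/= ge_min lexx orbT.
    by apply: ler_sum => k _; exact: (FP k).2.
  apply: (@le_trans _ _ (\sum_(0 <= k < n.+1)
      (daniell_outer (B k) + (e / (2 ^ k.+1)%:R)%:E))%E).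
    by apply: lee_sum => k _; exact: (rP k).2.
  apply: nneseries_lim_ge => k _ _.
  by rewrite adde_ge0 ?daniell_outer_ge0// lee_fin ltW.
move: Gs; case: (\sum_(k <oo) _)%E => [s Gs|_|/(_ 0%N)//]; last exact: leey.
by apply: daniell_outer_le; exists G => // n; rewrite -lee_fin.
Qed.

HB.instance Definition _ := isOuterMeasure.Build R T daniell_outer
  daniell_outer0 daniell_outer_ge0 le_daniell_outer
  daniell_outer_sigma_subadditive.

Definition daniell_outer_measure : {outer_measure set T -> \bar R} :=
  daniell_outer.

(* With p m = min(1, m (f - c)^+), which increases to the indicator of U, a
   cover F of Y splits into the cover min(F n, p n) of Y `&` U and the cover
   F n - min(F n, p m) of Y `\` U, at the cost of lam (p n) - lam (p m). *)
Lemma caratheodory_superlevel f c : V f ->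
  daniell_outer_measure.-caratheodory [set x | c < f x].
Proof.
move=> Vf; set U := [set x | _].
pose p (m : nat) : T -> R :=
  cst 1 \min (m%:R \*o ((f - cst c) - ((f - cst c) \min cst 0))).
have Vp m : V (p m).
  apply: vlattice_min => //; first exact: vlattice_cst.
  apply: vlatticeZ => //; apply: vlatticeB => //;
    last (apply: vlattice_min => //).
  - by apply: vlatticeB => //; exact: vlattice_cst.
  - by apply: vlatticeB => //; exact: vlattice_cst.
  - exact: vlattice_cst.
have pos x : 0 <= f x - c - Num.min (f x - c) 0.
  by rewrite subr_ge0 ge_min lexx.
have p0 m x : 0 <= p m x by rewrite /p/= !fctE le_min ler01/= mulr_ge0.
have p1 m x : p m x <= 1 by rewrite /p/= ge_min lexx.
have pS m n x : (m <= n)%N -> p m x <= p n x.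
  move=> mn; rewrite /p/= !fctE le_min ge_min lexx/= ge_min; apply/orP; right.
  by rewrite ler_wpM2r ?ler_nat.
have pU x : U x -> exists n, p n x = 1.
  move=> Ux; have fx0 : 0 < f x - c by rewrite subr_gt0.
  exists (Num.bound (f x - c)^-1); rewrite /p/= !fctE/=.
  have -> : Num.min (f x - c) 0 = 0 by apply/min_idPr/ltW.
  rewrite subr0; apply/min_idPl; rewrite -ler_pdivrMr// mul1r.
  by rewrite ltW// Num.Theory.archi_boundP// invr_ge0 ltW.
have pUC m x : ~ U x -> p m x = 0.
  move=> /negP; rewrite -leNgt => fx0; rewrite /p/= !fctE/=.
  have -> : Num.min (f x - c) 0 = f x - c by apply/min_idPl; rewrite subr_le0.
  by rewrite subrr mulr0; apply/min_idPr.
clearbody p.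
have lp1 m : lam (p m) <= 1.
  rewrite -[leRHS](positive_cst pl 1); apply: (positive_homo pl) => //.
  exact: vlattice_cst.
have lpS m n : (m <= n)%N -> lam (p m) <= lam (p n).
  by move=> mn; apply: (positive_homo pl) => // x; exact: pS.
have near_sup e : 0 < e -> exists m, forall n, lam (p n) <= lam (p m) + e.
  move=> e0; have sS : has_sup (range (lam \o p)).
    by split; [exists (lam (p 0%N)), 0%N|exists 1 => _ [n _ <-]; exact: lp1].
  have [_ [m _ <-] pm] := sup_adherent e0 sS.
  exists m => n; rewrite -lerBlDr; apply: le_trans (ltW pm).
  by rewrite lerD2r; apply: ub_le_sup; [exact: sS.2|exists n].
apply: le_caratheodory_measurable => Y.
apply: le_ereal_inf_tmp => _ [r [F cF Fr] <-].
apply/lee_addgt0Pr => e e0; have [m pm] := near_sup _ e0.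
pose A n := F n \min p n.
(* The index m is frozen here, as F n - min(F n, p n) need not increase with n. *)
pose B n := F n - (F n \min p m).
have cA : cover (Y `&` U) A.
  split.
  - by move=> n; apply: vlattice_min => //; exact: cover_mem cF _.
  - by move=> n x; rewrite /A/= le_min p0 (cover_ge0 cF).
  - by move=> n x; rewrite /A/= ge_min p1 orbT.
  - move=> k n x kn; rewrite /A/= le_min !ge_min.
    by rewrite (cover_homo cF)//= pS// orbT.
  - move=> x [Yx Ux] Xx d d0; have [k pk] := pU x Ux.
    have [n xn] := cover_sup cF Yx Xx d0.
    exists (maxn k n); rewrite /A/= lt_min; apply/andP; split.
      exact: lt_le_trans xn (cover_homo cF _ (leq_maxr _ _)).
    apply: lt_le_trans (pS _ _ x (leq_maxl _ _)); rewrite pk; lra.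
have cB : cover (Y `&` ~` U) B.
  split.
  - move=> n; have ? := cover_mem cF n.
    by apply: vlatticeB => //; apply: vlattice_min.
  - by move=> n x; rewrite /B !fctE/= subr_ge0 ge_min lexx.
  - move=> n x; rewrite /B !fctE/=; apply: le_trans (cover_le1 cF n x).
    by rewrite gerBl le_min p0 (cover_ge0 cF).
  - move=> k n x kn; rewrite /B !fctE/=; have := cover_homo cF x kn.
    by case: (leP (F k x) (p m x)); case: (leP (F n x) (p m x)); lra.
  - move=> x [Yx Ux] Xx d d0; have [n xn] := cover_sup cF Yx Xx d0.
    exists n; rewrite /B !fctE/= pUC//.
    have -> : Num.min (F n x) 0 = 0 by apply/min_idPr; exact: cover_ge0 cF _ _.
    by rewrite subr0.
have AB k n : lam (A k) + lam (B n) <= r + e.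
  pose N := maxn m (maxn k n).
  have mN : (m <= N)%N by rewrite leq_maxl.
  have kN : (k <= N)%N by rewrite /N !leq_max leqnn orbT.
  have nN : (n <= N)%N by rewrite /N !leq_max leqnn !orbT.
  apply: le_trans (lerD (lam_cover cA kN) (lam_cover cB nN)) _.
  have VFN := cover_mem cF N.
  have VFp i : V (F N \min p i) by exact: vlattice_min.
  rewrite /A /B (positiveB vV pl)//.
  have : lam (F N \min p N) - lam (F N \min p m) <= lam (p N) - lam (p m).
    rewrite -!(positiveB vV pl)//; apply: (positive_homo pl);
      [exact: vlatticeB|exact: vlatticeB|].
    move=> x; rewrite !fctE/=; have := pS _ _ x mN.
    by case: (leP (F N x) (p N x)); case: (leP (F N x) (p m x)); lra.
  by have := Fr N; have := pm N; lra.
(* s is the least upper sum of the cover [A]; by [AB] the number r + e - s is then an upper sum for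
   [B]. *)
pose s := sup (range (lam \o A)).
have sA : has_sup (range (lam \o A)).
  split; first by exists (lam (A 0%N)), 0%N.
  by exists (r + e - lam (B 0%N)) => _ [k _ <-] /=; have := AB k 0%N; lra.
apply: (@le_trans _ _ (s%:E + (r + e - s)%:E)%E).
  apply: leeD; apply: daniell_outer_le.
    exists A => // n; apply: ub_le_sup; [exact: sA.2|by exists n].
  exists B => // n; rewrite lerBrDr addrC -lerBrDr.
  by apply: ge_sup; [exact: sA.1|move=> _ [k _ <-] /=; have := AB k n; lra].
by rewrite -!EFinD lee_fin; lra.
Qed.

End Daniell.

(** * Integral representation of positive functionals *)

Section ProbabilityOfSetFunction.
Context d (T : measurableType d) (R : realType) (m : set T -> \bar R).
Context (m0 : m set0 = 0%E) (mge0 : forall A, (0 <= m A)%E).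
Context (msigma : semi_sigma_additive m) (mT : m setT = 1%E).

Let mu := m.
HB.instance Definition _ := isMeasure.Build d T R mu m0 mge0 msigma.
HB.instance Definition _ := Measure_isProbability.Build d T R mu mT.

Lemma exists_probability : exists P : probability T R, forall A, P A = m A.
Proof. by exists mu. Qed.

End ProbabilityOfSetFunction.

Lemma sum_clamp (R : realType) n (s : R) : 0 <= s ->
  \sum_(j < n) Num.min 1 (s - j%:R - Num.min (s - j%:R) 0) = Num.min s n%:R.
Proof.
move=> s0; elim: n => [|n IH]; first by rewrite big_ord0; apply/esym/min_idPr.
rewrite big_ord_recr/= {}IH -natr1.
case: (leP (s - n%:R) 0); case: (leP s (n%:R + 1)); case: (leP s n%:R);
  by case: (leP 1 _); lra.
Qed.

(** For s >= 0 the right side is the integer part of s capped at n. Against [sum_clamp], counting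
    levels loses at most 1, an error that disappears after division by n. *)
Lemma sum_step_ge (R : realType) n (s : R) :
  Num.min (s - 1) n%:R <= \sum_(j < n) (j%:R + 1 <= s)%R%:R.
Proof.
elim: n => [|n IH]; first by rewrite big_ord0 ge_min lexx orbT.
rewrite big_ord_recr/= -natr1; move: IH.
case: (leP (s - 1) n%:R); case: (leP (s - 1) (n%:R + 1));
  by case: (leP (n%:R + 1) s) => /=; lra.
Qed.

Section PositiveFunctionalIntegral.
Context (R : realType) d (T : measurableType d) (P : probability T R).
Context (V : set (T -> R)) (lam : (T -> R) -> R).
Context (vV : vlattice V) (pl : unital_positive V lam).
Hypothesis Ple : forall g (B : set T), V g -> (forall x, 0 <= g x <= 1) ->
  measurable B -> (forall x, B x -> 1 <= g x) -> (P B <= (lam g)%:E)%E.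

Lemma bounded_integrable (f : T -> R) (M : R) : measurable_fun setT f ->
  (forall x, `|f x| <= M) -> P.-integrable setT (EFin \o f).
Proof.
move=> mf fM; apply: measurable_bounded_integrable => //.
  exact: le_lt_trans (probability_le1 P measurableT) (ltry _).
by exists M; split; [exact: num_real|move=> r Mr x _ /=;
  exact: le_trans (fM x) (ltW Mr)].
Qed.

(* n f is the sum of the truncations g j = min(1, (n f - j)^+), j < n, and g j
   dominates the indicator of B j = {n f >= j + 1}. *)
Lemma Rintegral_le_positive (f : T -> R) : V f -> measurable_fun setT f ->
  (forall x, 0 <= f x <= 1) -> \int[P]_x f x <= lam f.
Proof.
move=> Vf mf f01.
pose B (n j : nat) := [set x | j%:R + 1 <= n%:R * f x].
have mB n j : measurable (B n j).
  rewrite -[B n j]setTI; apply: (@measurable_fun_le _ _ _ setT (cst (j%:R + 1))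
    (cst n%:R \* f)) => //.
  exact: (@measurable_funM _ _ _ _ (cst n%:R) f).
have iB n j : P.-integrable setT (EFin \o (\1_(B n j) : T -> R)).
  apply: (@bounded_integrable _ 1) => [|x]; first exact: measurable_indic.
  by rewrite indicE; case: (_ \in _); rewrite ?normr1 ?normr0.
pose S n k : T -> R := fun x => \sum_(j < k) \1_(B n j) x.
have isum n k : P.-integrable setT (EFin \o S n k).
  elim: k => [|k IH].
    rewrite (_ : _ \o _ = cst 0%E); first exact: integrable0.
    by apply/funext => x /=; rewrite /S big_ord0.
  rewrite (_ : _ \o _ = fun x => ((EFin \o S n k) x
      + (EFin \o (\1_(B n k) : T -> R)) x)%E); first exact: integrableD.
  by apply/funext => x /=; rewrite /S big_ord_recr.
have sumB n k : \int[P]_x S n k x = \sum_(j < k) fine (P (B n j)).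
  elim: k => [|k IH].
    rewrite big_ord0 (_ : S n 0%N = cst 0); last first.
      by apply/funext => x; rewrite /S big_ord0.
    by rewrite Rintegral_cst// mul0r.
  rewrite big_ord_recr/= -IH.
  have -> : S n k.+1 = fun x => S n k x + \1_(B n k) x.
    by apply/funext => x; rewrite /S big_ord_recr.
  rewrite RintegralD//; congr (_ + _).
  by rewrite /Rintegral integral_indic// setIT.
pose g (n j : nat) : T -> R := cst 1 \min ((n%:R \*o f - cst j%:R) -
  ((n%:R \*o f - cst j%:R) \min cst 0)).
have Vg n j : V (g n j).
  have V1 : V (n%:R \*o f - cst j%:R).
    by apply: vlatticeB => //; [exact: vlatticeZ|exact: vlattice_cst].
  apply: vlattice_min => //; first exact: vlattice_cst.
  by apply: vlatticeB => //; apply: vlattice_min => //; exact: vlattice_cst.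
have PB n j : fine (P (B n j)) <= lam (g n j).
  rewrite -lee_fin fineK; last exact: fin_num_measure.
  apply: Ple => // x.
    by rewrite /g/= !fctE/= le_min ler01 subr_ge0 !ge_min !lexx.
  move=> jx; have {}jx : j%:R + 1 <= n%:R * f x := jx.
  rewrite /g/= ?fctE/= le_min lexx/=.
  by case: (leP (n%:R * f x - j%:R) 0); lra.
have sumg n k : lam (fun x => \sum_(j < k) g n j x) = \sum_(j < k) lam (g n j)
    /\ V (fun x => \sum_(j < k) g n j x).
  elim: k => [|k [IH VI]].
    rewrite (_ : (fun x => _) = cst 0); last first.
      by apply/funext => x; rewrite big_ord0.
    by rewrite (positive_cst pl) big_ord0; split=> //; exact: vlattice_cst.
  rewrite (_ : (fun x => _) = (fun x => \sum_(j < k) g n j x) + g n k);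
    last first.
    by apply/funext => x; rewrite big_ord_recr.
  by split; [rewrite (positiveD pl)// IH big_ord_recr|exact: vlatticeD].
have gE n : (fun x => \sum_(j < n) g n j x) = n%:R \*o f.
  apply/funext => x /=; rewrite /g/= !fctE/=.
  have /andP[f0 f1] := f01 x.
  rewrite sum_clamp ?mulr_ge0//; apply/min_idPl.
  by rewrite ler_piMr.
have intf : P.-integrable setT (EFin \o f).
  by apply: (@bounded_integrable _ 1) => // x; have /andP[f0 f1] := f01 x;
    rewrite ger0_norm.
have key n : n%:R * \int[P]_x f x <= 1 + n%:R * lam f.
  rewrite -(positiveZ pl)// -gE (sumg n n).1.
  apply: (@le_trans _ _ (1 + \sum_(j < n) fine (P (B n j)))); last first.
    by rewrite lerD2l; apply: ler_sum => j _; exact: PB.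
  have intc : P.-integrable setT (EFin \o (cst 1 : T -> R)).
    by apply: (@bounded_integrable _ 1) => // x; rewrite normr1.
  have <- : \int[P]_x (1 + S n n x) = 1 + \sum_(j < n) fine (P (B n j)).
    rewrite RintegralD// sumB Rintegral_cst// mul1r.
    by congr (_ + _); rewrite -[RHS]/(fine 1%E) -(probability_setT P).
  rewrite -RintegralZl//; apply: le_Rintegral => //.
  - apply: (@bounded_integrable _ n%:R) => [|x].
      exact: (@measurable_funM _ _ _ _ (cst n%:R) f).
    have /andP[f0 f1] := f01 x.
    by rewrite ger0_norm ?mulr_ge0// ler_piMr.
  - rewrite (_ : _ \o _ = fun x => ((EFin \o (cst 1%R : T ->
      R)) x + (EFin \o S n n) x)%E)//.
    exact: integrableD.
  - move=> x _; have := sum_step_ge n (n%:R * f x).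
    rewrite (_ : Num.min _ _ = n%:R * f x - 1); last first.
      have /andP[f0 f1] := f01 x.
      apply/min_idPl; apply: (@le_trans _ _ (n%:R * f x)); first by lra.
      by rewrite ler_piMr.
    rewrite /S (eq_bigr (fun j : 'I_n => \1_(B n j) x)); first by lra.
    by move=> j _; rewrite indicE; congr (nat_of_bool _)%:R;
      apply/idP/idP => [/mem_set|/set_mem].
apply/ler_addgt0Pr => e e0.
have [n ne] : exists n : nat, e^-1 < n%:R.
  exists (Num.bound e^-1).
  by rewrite Num.Theory.archi_boundP// invr_ge0 ltW.
have n0 : 0 < n%:R :> R by apply: lt_trans ne; rewrite invr_gt0.
rewrite -(ler_pM2l n0) mulrDr; apply: le_trans (key n) _.
rewrite addrC lerD2l -ler_pdivrMr// mul1r ltW//.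
Qed.

(** [Ple], the only link between P and lam, gives a one-sided bound for values in [0, 1]. It carries
    over to bounded functions by an affine change of values, which both sides respect because both
    have mass 1. Applied to f and - f it gives equality. *)
Lemma Rintegral_positive (f : T -> R) (M : R) : V f -> measurable_fun setT f ->
  (forall x, `|f x| <= M) -> \int[P]_x f x = lam f.
Proof.
have half g : V g -> measurable_fun setT g -> (forall x, `|g x| <= M) ->
    \int[P]_x g x <= lam g.
  move=> Vg mg gM.
  pose K := `|M| + 1.
  have K0 : 0 < K by rewrite ltr_wpDl.
  have K2 : 0 < (2 * K)^-1 by rewrite invr_gt0 mulr_gt0.
  have gK x : - K <= g x <= K.
    by rewrite -ler_norml /K; apply: le_trans (gM x) _; have := ler_norm M; lra.
  pose h := (2 * K)^-1 \*o (g + cst K).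
  have Vh : V h by apply: vlatticeZ => //; apply: vlatticeD => //;
    exact: vlattice_cst.
  have mh : measurable_fun setT h.
    apply: (@measurable_funM _ _ _ _ (cst _) (g + cst K)) => //.
    exact: measurable_funD.
  have h01 x : 0 <= h x <= 1.
    rewrite /h/= !fctE; have := gK x => /andP[g1 g2].
    apply/andP; split; first by rewrite mulr_ge0 ?(ltW K2)//; lra.
    by rewrite mulrC ler_pdivrMr ?mulr_gt0//; lra.
  have := Rintegral_le_positive Vh mh h01.
  have ig : P.-integrable setT (EFin \o g) by exact: bounded_integrable gM.
  have iK : P.-integrable setT (EFin \o (cst K : T -> R)).
    by apply: (@bounded_integrable _ K) => // x /=; rewrite gtr0_norm.
  have igK : P.-integrable setT (EFin \o (g + cst K)).
    rewrite (_ : _ \o _ = fun x => ((EFin \o g) x + (EFin \o (cst K : T ->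
      R)) x)%E)//.
    exact: integrableD.
  rewrite /h (positiveZ pl); last by apply: vlatticeD => //;
    exact: vlattice_cst.
  rewrite (positiveD pl)//; last exact: vlattice_cst.
  rewrite (positive_cst pl) [X in X <= _]RintegralZl// ler_pM2l//.
  rewrite RintegralD// Rintegral_cst// (_ : fine (_ setT) = 1) ?mulr1 ?lerD2r//.
  by rewrite -[RHS]/(fine 1%E) -(probability_setT P).
move=> Vf mf fM; apply/eqP; rewrite eq_le half//=.
have Vn : V (-1 \*o f) by exact: vlatticeZ.
have mn : measurable_fun setT (-1 \*o f).
  exact: (@measurable_funM _ _ _ _ (cst _) f).
have nM x : `|(-1 \*o f) x| <= M by rewrite /= mulN1r normrN.
have := half _ Vn mn nM.
rewrite (positiveZ pl)// RintegralZl//; last exact: bounded_integrable fM.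
by rewrite !mulN1r lerN2.
Qed.

End PositiveFunctionalIntegral.

(** * The Choquet-Bishop-de Leeuw theorem *)

Section BaireMeasurability.
Context (R : realType) (T : topologicalType) (V : set (T -> R)).
Context (lam : (T -> R) -> R) (vV : vlattice V) (pl : unital_positive V lam).
Context (X : set T) (x0 : T) (cT : compact [set: T]).
Hypothesis Vbase : forall x (U : set T), nbhs x U -> exists w : T -> R,
  [/\ V w, continuous w, 0 < w x & forall y, 0 < w y -> U y].

Let mu : {outer_measure set (baireType R x0) -> \bar R} :=
  daniell_outer_measure vV pl X.

(** The set {f > c} is the union of the compact sets {f >= c + 1/(n+1)}. Each of these is covered by
    finitely many sets {w > 0} inside {f > c} with w in V, measurable by [caratheodory_superlevel].
    So f itself is never approximated by elements of V. *)
Lemma caratheodory_continuous_superlevel (f : T -> R) c : continuous f ->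
  mu.-caratheodory [set x | c < f x].
Proof.
move=> cf; set U := [set x | _].
have oU : open U.
  by rewrite (_ : U = f @^-1` [set r | c < r])//; apply: open_comp => // ? _;
    exact: cf.
have /choice[w wP] (x : T) : exists w : T -> R, [/\ V w, continuous w,
    U x -> 0 < w x & forall y, 0 < w y -> U y].
  have [Ux|nUx] := pselect (U x).
    have [|w [Vw cw wx wU]] := @Vbase x U; first exact: open_nbhs_nbhs.
    by exists w.
  (* Points outside U get the zero function, whose positivity set is empty. *)
  exists (cst 0); split=> //= [||y];
    [exact: vlattice_cst|exact: cst_continuous|].
  by rewrite ltxx.
have mw x : mu.-cara.-measurable ([set y | 0 < w x y] :
  set (caratheodory_type mu)).
  by have [Vw _ _ _] := wP x; exact: caratheodory_superlevel.
have /choice[W WP] n : exists W : set (caratheodory_type mu),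
    [/\ measurable W, [set x | c + n.+1%:R^-1 <= f x] `<=` W & W `<=` U].
  set K := [set x | _].
  have cK : @compact T K.
    apply: (@subclosed_compact _ _ setT) => //.
    rewrite (_ : K = f @^-1` [set r | c + n.+1%:R^-1 <= r])//.
    by apply: closed_comp => [x _|]; [exact: cf|exact: closed_ge].
  have KU : K `<=` U.
    by move=> x /= Kx; apply: lt_le_trans Kx; rewrite ltrDl invr_gt0.
  pose O : set (set T) := [set W | mu.-caratheodory W /\ W `<=` U].
  apply: contrapT => nW.
  (* [O] is closed under finite unions. If none of its sets contained K, their complements in K
     would have a cluster point p, which {w p > 0} excludes. *)
  have FF : ProperFilter (filter_from O (fun W => K `&` ~` W)).
    apply: filter_from_proper => [|W [mW WU]]; last first.
      apply: contrapT => /nonemptyPn KW; apply: nW; exists W; split=> // x Kx.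
      by apply: contrapT => Wx; have : set0 x by rewrite -KW.
    apply: filter_from_filter => [|W1 W2 [m1 W1U] [m2 W2U]].
      by exists set0; split=> //; exact: caratheodory_measurable_set0.
    exists (W1 `|` W2); last by move=> x [Kx]; rewrite setCU => -[].
    by split; [exact: caratheodory_measurable_setU|move=> x [/W1U|/W2U]].
  have [|p [Kp clp]] := cK _ FF.
    exists set0; first by split=> //; exact: caratheodory_measurable_set0.
    by move=> x [].
  have [_ cw wp wU] := wP p.
  have [||y [[_ ny] wy]] := clp (K `&` ~` [set y | 0 < w p y]) [set y | 0 < w p
    y].
  - by exists [set y | 0 < w p y] => //; split; [exact: mw|exact: wU].
  - apply: open_nbhs_nbhs; split; last exact: wp (KU _ Kp).
    rewrite (_ : [set y | _] = w p @^-1` [set r | 0 < r])//.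
    by apply: open_comp => // ? _; exact: cw.
  - exact: ny.
suff -> : U = \bigcup_n W n.
  by apply: caratheodory_measurable_bigcup => n; have [] := WP n.
apply/seteqP; split=> [y Uy|y [n _]]; last by have [_ _] := WP n; exact.
have fy : 0 < f y - c by rewrite subr_gt0.
pose n := Num.bound (f y - c)^-1.
exists n => //; have [_ + _] := WP n; apply => /=.
rewrite -lerBrDl invf_ple ?posrE//.
apply: ltW; apply: lt_le_trans (Num.Theory.archi_boundP _) _.
  by rewrite invr_ge0 ltW.
by rewrite ler_nat.
Qed.

Lemma baire_caratheodory (B : set (baireType R x0)) : measurable B ->
  mu.-caratheodory B.
Proof.
move: B; apply: smallest_sub.
  split.
  - exact: caratheodory_measurable_set0.
  - by move=> B mB; rewrite setTD; exact: caratheodory_measurable_setC.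
  - by move=> F mF; exact: caratheodory_measurable_bigcup.
move=> _ [f cf [Y mY ->]].
have mf : measurable_fun setT (f : caratheodory_type mu -> R).
  apply: (measurability _ (@RGenOInfty.measurableE R)) => _ [_ [c ->] <-].
  rewrite setTI (_ : f @^-1` _ = [set x | c < f x]).
    exact: caratheodory_continuous_superlevel.
  by apply/seteqP; split=> x; rewrite /= in_itv/= andbT.
by have := mf measurableT _ mY; rewrite setTI.
Qed.

Lemma baire_measurable_continuous (f : T -> R) : continuous f ->
  measurable_fun setT (f : baireType R x0 -> R).
Proof.
by move=> cf _ Y mY; rewrite setTI; apply: sub_sigma_algebra; exists f => //;
  exists Y.
Qed.

Hypothesis daniell : forall F r, cover V X setT F ->
  (forall n, lam (F n) <= r) -> 1 <= r.
Hypothesis Vcont : forall f, V f -> continuous f.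

(** Total mass 1 comes from [daniell], countable additivity from Caratheodory's theorem, as Baire
    sets are measurable for the outer measure, and the integral formula from constant sequences as
    covers. *)
Theorem daniell_representation : exists P : probability (baireType R x0) R,
  (forall B : set (baireType R x0), B `&` X = set0 -> P B = 0%E) /\
  forall f : T -> R, V f ->
    P.-integrable setT (EFin \o (f : baireType R x0 -> R)) /\
    \int[P]_x f x = lam f.
Proof.
have muT : mu setT = 1%E.
  apply/eqP; rewrite eq_le daniell_outer_le1//=.
  apply: le_ereal_inf_tmp => _ [r [F cF Fr] <-].
  by rewrite lee_fin; exact: daniell cF Fr.
have [||||P PE] := @exists_probability _ (baireType R x0) R (mu :
  set (baireType R x0) -> \bar R).
- exact: outer_measure0.
- exact: outer_measure_ge0.
- move=> F mF tF mUF; apply: (@caratheodory_measure_sigma_additive R _ mu) =>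
    //.
    by move=> n; exact: baire_caratheodory.
  exact: baire_caratheodory.
- exact: muT.
exists P; split=> [B BX|f Vf].
  by rewrite PE; exact: daniell_outer_disjoint.
have mf := baire_measurable_continuous (Vcont Vf).
have [M fM] : exists M, forall x, `|f x| <= M.
  have [m mf'] := continuous_lbound cT x0 (Vcont Vf).
  have [M fM] := continuous_ubound cT x0 (Vcont Vf).
  exists (Num.max (- m) M) => x; rewrite ler_norml lerNl !le_max fM orbT andbT.
  by rewrite lerN2 mf'.
split; first exact: (@bounded_integrable R _ (baireType R x0) P f M).
apply: (@Rintegral_positive R _ (baireType R x0) P V lam vV pl _ f M) => // g B
  Vg g01 mB Bg.
by rewrite PE; exact: daniell_outer_le_lam.
Qed.

End BaireMeasurability.

(** * The minimal functional on differences of concave functions *)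

Section ChoquetBishopDeLeeuw.
Context (R : realType) (T : topologicalType).
Context (cmb : R -> T -> T -> T -> Prop).
Context (cT : compact [set: T]) (phi : T).
Notation ccv := (ccv cmb).
Hypothesis sep : forall x y, x <> y -> exists2 w : T -> R, ccv w & w x <> w y.
Hypothesis base : forall x (U : set T), nbhs x U -> exists w : T -> R,
  [/\ ccv w, 0 < w x & forall y, 0 < w y -> U y].

(** [additive_dominated] gives additivity only when one summand is concave; on differences of
    concave functions this amounts to linearity. *)
Let V : set (T -> R) := [set f | exists w1 w2, [/\ ccv w1,
  ccv w2 & f = w1 - w2]].

Let ccv_V w : ccv w -> V w.
Proof.
move=> cw; exists w, (cst 0); split=> //; first exact: ccv_cst.
by apply/funext => x; rewrite !fctE subr0.
Qed.

Let V_cont f : V f -> continuous f.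
Proof. by move=> [w1 [w2 [[c1 _] [c2 _] ->]]]; exact: continuous_fctB. Qed.

Let vlattice_V : vlattice V.
Proof.
split.
- move=> _ _ [f1 [f2 [cf1 cf2 ->]]] [g1 [g2 [cg1 cg2 ->]]].
  exists (f1 + g1), (f2 + g2); split; [exact: ccvD|exact: ccvD|].
  by apply/funext => x; rewrite !fctE; lra.
- move=> c _ [f1 [f2 [cf1 cf2 ->]]]; have [c0|c0] := leP 0 c.
    exists (c \*o f1), (c \*o f2); split; [exact: ccvZ|exact: ccvZ|].
    by apply/funext => x; rewrite !fctE/= mulrBr.
  exists (- c \*o f2), (- c \*o f1).
  split; [by apply: ccvZ => //; lra|by apply: ccvZ => //; lra|].
  by apply/funext => x; rewrite !fctE/=; lra.
- by move=> c; apply: ccv_V; exact: ccv_cst.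
- move=> _ _ [f1 [f2 [cf1 cf2 ->]]] [g1 [g2 [cg1 cg2 ->]]].
  (* Adding f2 + g2 to both arguments of min(f1 - f2, g1 - g2) makes them concave. *)
  exists ((f1 + g2) \min (g1 + f2)), (f2 + g2).
  split; [by apply: ccv_min; exact: ccvD|exact: ccvD|].
  apply/funext => x; rewrite ?fctE/= ?fctE.
  by case: (leP (f1 x - f2 x) _); case: (leP (f1 x + g2 x) _); lra.
Qed.

Theorem choquet_bishop_deleeuw : exists P : probability (baireType R phi) R,
  (forall B : set (baireType R phi), B `&` ext_points cmb = set0 ->
    P B = 0%E) /\
  forall a : T -> R, ccv a -> ccv (-1 \*o a) ->
    P.-integrable setT (EFin \o (a : baireType R phi -> R)) /\
    \int[P]_x a x = a phi.
Proof.
have [q [dq qD]] := additive_dominated cmb cT phi.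
have qB w1 w2 : ccv w1 -> ccv w2 -> q (w1 - w2) = q w1 - q w2.
  move=> c1 c2; have := qD w2 (w1 - w2) c2 (continuous_fctB c1.1 c2.1).
  by rewrite [w2 + _]addrC subrK; lra.
have pq : unital_positive V q.
  split.
  - move=> _ _ [f1 [f2 [cf1 cf2 ->]]] [g1 [g2 [cg1 cg2 ->]]].
    rewrite addrACA -opprD !qB//; [|exact: ccvD|exact: ccvD].
    by rewrite (qD f1)//; [rewrite (qD f2)//; [lra|exact: cg2.1]|exact: cg1.1].
  - move=> c f Vf; have [c0|c0|<-] := ltgtP 0 c.
    + by apply: (dominatedZ dq) => //; exact: V_cont.
    + have [f1 [f2 [cf1 cf2 ->]]] := Vf.
      rewrite (_ : c \*o _ = - c \*o (f2 - f1)); last first.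
        by apply/funext => x; rewrite /= ?fctE; lra.
      rewrite (dominatedZ dq) ?oppr_gt0//;
        last exact: continuous_fctB cf2.1 cf1.1.
      by rewrite (qB f2 f1)// (qB f1 f2)//; ring.
    + rewrite mul0r -[RHS](dominated_cst 0 dq); congr q.
      by apply/funext => x /=; rewrite mul0r.
  - by move=> f g Vf Vg; apply: (dominated_homo dq); exact: V_cont.
  - by move=> c; exact: dominated_cst dq.
have [|F r cF Fr||P [P0 Pint]] :=
    @daniell_representation R T V q vlattice_V pq (ext_points cmb) phi cT.
- move=> x U xU; have [w [cw wx wU]] := base xU.
  by exists w; split=> //; [exact: ccv_V|exact: cw.1].
(* The functions F n - 1 <= 0 increase to 0 at every extreme point, so Simons' inequality gives q (F
   n) >= 1 - e for some n. *)
- apply/ler_addgt0Pr => e e0; have cF1 n : continuous (F n - cst 1).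
    by apply: continuous_fctB;
      [exact: V_cont (cover_mem cF n)|exact: cst_continuous].
  have [||||n qn] := @simons R T cmb cT phi sep q dq (fun n => F n - cst 1) _ _
    _ _ e e0.
  + exact: cF1.
  + by move=> n x; rewrite !fctE subr_le0; exact: cover_le1 cF n x.
  + move=> n x; rewrite !fctE lerD2r; apply: (cover_homo cF); exact: leqnSn.
  + move=> x xext d d0; have [n xn] := cover_sup cF I xext d0.
    by exists n; rewrite !fctE; lra.
  have := qD (cst 1) _ (ccv_cst cmb 1) (cF1 n).
  rewrite (dominated_cst 1 dq) [cst 1 + _]addrC subrK.
  by have := Fr n; lra.
- exact: V_cont.
exists P; split=> // a ca cNa; have [ia ->] := Pint a (ccv_V ca).
split=> //; apply/eqP; rewrite eq_le (dominated_ccv dq)//=.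
have := dominated_ccv dq cNa; rewrite (positiveZ pq) /=; last exact: ccv_V.
lra.
Qed.

End ChoquetBishopDeLeeuw.

(** * Riesz representation in Hilbert spaces *)

Section ComplexParts.
Context (R : realType).
Implicit Types z w : R[i].

Lemma Re_D z w : complex.Re (z + w) = complex.Re z + complex.Re w.
Proof. by case: z; case: w. Qed.

Lemma Re_N z : complex.Re (- z) = - complex.Re z.
Proof. by case: z. Qed.

Lemma Im_D z w : complex.Im (z + w) = complex.Im z + complex.Im w.
Proof. by case: z; case: w. Qed.

Lemma Im_N z : complex.Im (- z) = - complex.Im z.
Proof. by case: z. Qed.

Lemma Re_RM (r : R) z : complex.Re (r%:C%C * z) = r * complex.Re z.
Proof. by case: z => a b /=; rewrite mul0r subr0. Qed.

Lemma Re_conj z : complex.Re (Num.conj z) = complex.Re z.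
Proof. by case: z. Qed.

Lemma Re_le z w : z <= w -> complex.Re z <= complex.Re w.
Proof. by rewrite lecE => /andP[]. Qed.

Lemma ge0_ReE z : 0 <= z -> z = (complex.Re z)%:C%C.
Proof. by rewrite lecE => /andP[/eqP]; case: z => a b /= ->. Qed.

End ComplexParts.

Section RealHilbert.
Context (R : realType) (H : hilbertType R).
Implicit Types (x y z : H) (r : R).

(** Limits, bounds and measures below are all real; [Im_inner] and [inner_ext] recover the complex
    form from its real part. *)
Definition rip x y : R := complex.Re (inner x y).
Definition rnorm x : R := complex.Re `|x|.

Lemma innerDl x y z : inner (x + y) z = inner x z + inner y z.
Proof. exact: linearDl. Qed.

Lemma innerZl (c : R[i]) x y : inner (c *: x) y = c * inner x y.
Proof. exact: linearZl_LR. Qed.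

Lemma innerZr (c : R[i]) x y : inner x (c *: y) = Num.conj c * inner x y.
Proof. exact: linearZr_LR. Qed.

Lemma innerC x y : inner x y = Num.conj (inner y x).
Proof. by rewrite hermC expr0 mul1r. Qed.

Lemma ripC x y : rip x y = rip y x.
Proof. by rewrite /rip innerC Re_conj. Qed.

Lemma ripDl x y z : rip (x + y) z = rip x z + rip y z.
Proof. by rewrite /rip innerDl Re_D. Qed.

Lemma ripDr x y z : rip x (y + z) = rip x y + rip x z.
Proof. by rewrite !(ripC x) ripDl. Qed.

Lemma ripZl r x y : rip (r%:C%C *: x) y = r * rip x y.
Proof. by rewrite /rip innerZl Re_RM. Qed.

Lemma ripZr r x y : rip x (r%:C%C *: y) = r * rip x y.
Proof. by rewrite !(ripC x) ripZl. Qed.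

Lemma ripNl x y : rip (- x) y = - rip x y.
Proof. by rewrite /rip linearNl Re_N. Qed.

Lemma ripNr x y : rip x (- y) = - rip x y.
Proof. by rewrite !(ripC x) ripNl. Qed.

Lemma rip0l y : rip 0 y = 0. Proof. by rewrite /rip linear0l. Qed.

Lemma rip_suml n (F : 'I_n -> H) y : rip (\sum_i F i) y = \sum_i rip (F i) y.
Proof. by elim/big_rec2: _ => [|i a b _ <-]; rewrite ?rip0l ?ripDl. Qed.

Lemma Im_inner x y : complex.Im (inner x y) = rip x ('i%C *: y).
Proof. by rewrite /rip innerZr; case: (inner x y) => a b /=; lra. Qed.

Lemma inner_ext x y u v :
  rip x y = rip u v -> rip x ('i%C *: y) = rip u ('i%C *: v) ->
  inner x y = inner u v.
Proof.
rewrite -!Im_inner /rip.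
by case: (inner x y) (inner u v) => a b [c d] /= -> ->.
Qed.

Lemma normE x : `|x| = (rnorm x)%:C%C.
Proof. exact: ge0_ReE (normr_ge0 x). Qed.

Lemma rnorm_ge0 x : 0 <= rnorm x.
Proof. exact: Re_norm_ge0. Qed.

Lemma rnorm2 x : rnorm x ^+ 2 = rip x x.
Proof. by rewrite /rip -inner_norm normE -rmorphXn. Qed.

Lemma rip_ge0 x : 0 <= rip x x.
Proof. by rewrite -rnorm2 sqr_ge0. Qed.

Lemma rnorm0_eq0 x : rnorm x = 0 -> x = 0.
Proof. by move=> x0; apply/eqP; rewrite -normr_eq0 normE x0. Qed.

Lemma rip_eq0 x : rip x x = 0 -> x = 0.
Proof.
by rewrite -rnorm2 => /eqP; rewrite sqrf_eq0 => /eqP; exact: rnorm0_eq0.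
Qed.

Lemma rip_inj x y : (forall z, rip x z = rip y z) -> x = y.
Proof.
move=> xy; apply/eqP; rewrite -subr_eq0; apply/eqP; apply: rip_eq0.
by rewrite ripDl ripNl xy subrr.
Qed.

Lemma rip_sqr_le x y : rip x y ^+ 2 <= rip x x * rip y y.
Proof.
have [y0|y0] := eqVneq (rip y y) 0.
  by rewrite (rip_eq0 y0) ripC !rip0l mulr0 expr0n.
have yy : 0 < rip y y by rewrite lt_neqAle eq_sym y0 rip_ge0.
have := rip_ge0 (x + (- (rip x y / rip y y))%:C%C *: y).
rewrite ripDl !ripDr !ripZl !ripZr (ripC y x).
rewrite [leRHS](_ : _ = (rip x x * rip y y - rip x y ^+ 2) / rip y y).
  by rewrite pmulr_lge0 ?invr_gt0// subr_ge0.
by field.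
Qed.

Lemma rip_le x y : `|rip x y| <= rnorm x * rnorm y.
Proof.
rewrite -ler_sqr ?nnegrE ?mulr_ge0 ?rnorm_ge0//.
by rewrite real_normK ?num_real// exprMn !rnorm2 rip_sqr_le.
Qed.

Lemma rnormZ (r : R) x : rnorm (r%:C%C *: x) = `|r| * rnorm x.
Proof.
by apply/eqP; rewrite -(@eqrXn2 _ 2) ?mulr_ge0 ?rnorm_ge0//;
  rewrite exprMn !rnorm2 ripZl ripZr real_normK ?num_real// mulrA.
Qed.

(* The sublevel sets of |x|^2 - 2 l x near its infimum form a Cauchy filter,
   by the parallelogram identity. *)
Lemma riesz_representation (l : H -> R) (M : R) :
  (forall x y, l (x + y) = l x + l y) ->
  (forall r x, l (r%:C%C *: x) = r * l x) ->
  (forall x, `|l x| <= M * rnorm x) ->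
  exists z, forall x, l x = rip z x.
Proof.
move=> lD lZ lM.
(* For the vector z sought, J x = |x - z|^2 - |z|^2, so z has to be the minimizer of J. *)
pose J x := rip x x - 2 * l x.
have JM x : - M ^+ 2 <= J x.
  have := lM x; rewrite ler_norml /J -rnorm2 => /andP[_ lxM].
  have := sqr_ge0 (rnorm x - M); rewrite sqrrB; lra.
pose m := inf (range J).
have Jm x : m <= J x.
  by apply: ge_inf; [exists (- M ^+ 2) => _ [y _ <-]|exists x].
have Jadh e : 0 < e -> exists x, J x < m + e.
  move=> e0; have iJ : has_inf (range J).
    by split; [exists (J 0), 0|exists (- M ^+ 2) => _ [y _ <-]].
  by have [_ [x _ <-] xe] := inf_adherent e0 iJ; exists x.
pose F := filter_from [set e : R | 0 < e] (fun e => [set x | J x < m + e]).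
have FF : ProperFilter F.
  apply: filter_from_proper => [|e /Jadh//].
  apply: filter_from_filter => [|e f e0 f0]; first by exists 1 => /=.
  exists (Num.min e f); first by rewrite /= lt_min; apply/andP.
  by move=> x /=; rewrite -ltrBlDl lt_min !ltrBlDl => /andP[].
have close e x y : J x < m + e -> J y < m + e -> rnorm (x - y) ^+ 2 < 4 * e.
  move=> xe ye; have := Jm ((2^-1)%:C%C *: (x + y)).
  rewrite /J in xe ye *.
  rewrite lZ lD rnorm2 !(ripZl, ripZr, ripDl, ripDr, ripNl, ripNr) (ripC y x).
  lra.
have cF : cauchy F.
  apply: cauchy_exP => e' e'0.
  have e'E := ge0_ReE (ltW e'0).
  have e0 : 0 < complex.Re e' by move: e'0; rewrite e'E ltcR.
  set e := complex.Re e' in e'E e0.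
  have e4 : 0 < e ^+ 2 / 4 by rewrite divr_gt0// exprn_gt0.
  have [x xe] := Jadh _ e4; exists x.
  exists (e ^+ 2 / 4) => // y /= ye.
  rewrite -ball_normE /= e'E normE ltcR.
  have := close _ _ _ xe ye; rewrite mulrCA divff// mulr1.
  by rewrite ltr_pXn2r ?nnegrE ?rnorm_ge0 ?ltW.
have /cvg_ex[z zF] := @cauchy_cvg H F FF cF.
exists z => v; apply/eqP; rewrite eq_sym -subr_eq0 -sqrf_eq0 eq_le sqr_ge0
  andbT.
set D := rip z v - l v; set B := rip v v.
have B0 : 0 <= B by exact: rip_ge0.
have key e : 0 < e -> D ^+ 2 <= e * (2 + 4 * B).
  move=> e0.
  have : F (ball z (Num.sqrt e)%:C%C).
    by apply: zF; apply: nbhsx_ballx; rewrite ltcR sqrtr_gt0.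
  move=> Fb; have FJ : F [set x | J x < m + e] by exists e.
  have [x [zx xe]] := filter_ex (filterI Fb FJ).
  have {}xe : J x < m + e := xe.
  have {}zx : rip (z - x) (z - x) <= e.
    move: zx; rewrite -ball_normE /= normE ltcR => zx.
    rewrite -rnorm2 -[e]sqr_sqrtr ?(ltW e0)//.
    by rewrite ler_sqr ?nnegrE ?rnorm_ge0 ?sqrtr_ge0// ltW.
  pose A := rip x v - l v.
  have A2 : A ^+ 2 <= e * (1 + B).
    (* Moving x by - d A v changes J by - 2 d A^2 + d^2 B A^2, which is at least - e as x is nearly
       minimal. Taking 1 / (1 + B) instead of the optimal 1 / B covers v = 0. *)
    pose d := (1 + B)^-1.
    have B1 : 0 < 1 + B by lra.
    have d0 : 0 < d by rewrite invr_gt0.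
    have := Jm (x + (- (d * A))%:C%C *: v).
    rewrite /J in xe *.
    rewrite lD lZ ripDl !ripDr !ripZl !ripZr (ripC v x) -/B.
    have -> : l v = rip x v - A by rewrite /A; lra.
    move=> h.
    have {}h : 2 * d * A ^+ 2 - d ^+ 2 * B * A ^+ 2 <= e by move: h xe; lra.
    have dB : d ^+ 2 * B <= d.
      rewrite expr2 -mulrA ger_pMr// /d mulrC ler_pdivrMr//; lra.
    have : d * A ^+ 2 <= e.
      by have := ler_wpM2r (sqr_ge0 A) dB; lra.
    by rewrite /d mulrC ler_pdivrMr.
  have -> : D = A + rip (z - x) v by rewrite /D /A ripDl ripNl; lra.
  have := rip_sqr_le (z - x) v; rewrite -/B => zxv.
  have : rip (z - x) v ^+ 2 <= e * B.
    by apply: le_trans zxv _; exact: ler_wpM2r.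
  have := sqr_ge0 (A - rip (z - x) v).
  rewrite (sqrrB A) (sqrrD A); lra.
apply/ler_addgt0Pr => e e0; rewrite add0r.
have B4 : 0 < 2 + 4 * B by lra.
have := key (e / (2 + 4 * B)); rewrite divfK ?gt_eqF//; apply.
by rewrite divr_gt0.
Qed.

End RealHilbert.

(** * Unital completely positive maps are completely contractive *)

Section BoundedForms.
Context (R : realType) (H : hilbertType R).
Implicit Types (f g : 'B(H)) (x y h k : H).

Lemma bopD f x y : f (x + y) = f x + f y.
Proof. by have [lf _] := bopP f; have := lf 1 x y; rewrite !scale1r. Qed.

Lemma bop0 f : f 0 = 0.
Proof. by have := bopD f 0 0; rewrite addr0 -[LHS]addr0 => /addrI. Qed.

Lemma bopZ f (c : R[i]) x : f (c *: x) = c *: f x.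
Proof. by have [lf _] := bopP f; have := lf c x 0;
  rewrite !addr0 bop0 addr0. Qed.

Lemma bop_bound f : exists2 M : R, 0 < M & forall x, rnorm (f x) <= M * rnorm x.
Proof.
have [_ [M fM]] := bopP f; exists (`|complex.Re M| + 1) => [|x].
  by rewrite ltr_wpDl.
have := Re_le (fM x); rewrite -/(rnorm _) (normE x) mulrC Re_RM => fx.
apply: le_trans fx _; rewrite mulrC ler_wpM2r ?rnorm_ge0//.
by have := ler_norm (complex.Re M); lra.
Qed.

Lemma rip_conjZ (c : R[i]) x y : rip (c *: x) y = rip x (Num.conj c *: y).
Proof. by rewrite /rip innerZl innerZr conjCK. Qed.

(* Real forms suffice: the real part of a sesquilinear form determines it. *)
Lemma bop_of_form (b : H -> H -> R) (M : R) :
  (forall h h' k, b (h + h') k = b h k + b h' k) ->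
  (forall h k k', b h (k + k') = b h k + b h k') ->
  (forall (r : R) h k, b h (r%:C%C *: k) = r * b h k) ->
  (forall (c : R[i]) h k, b (c *: h) k = b h (Num.conj c *: k)) ->
  (forall h k, `|b h k| <= M * rnorm h * rnorm k) ->
  exists f : 'B(H), forall h k, b h k = rip (f h) k.
Proof.
move=> bDl bDr bZr bZl bM.
have /choice[f fP] h : exists z, forall k, b h k = rip z k.
  by apply: (riesz_representation (M := M * rnorm h)).
have fb h : rnorm (f h) <= M * rnorm h.
  have [->|f0] := eqVneq (rnorm (f h)) 0.
    have [h0|h0] := eqVneq (rnorm h) 0; first by rewrite h0 mulr0.
    have hh : 0 < rnorm h by rewrite lt_neqAle eq_sym h0 rnorm_ge0.
    have := le_trans (normr_ge0 _) (bM h h); rewrite -mulrA.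
    by rewrite mulrA pmulr_lge0.
  have fh : 0 < rnorm (f h) by rewrite lt_neqAle eq_sym f0 rnorm_ge0.
  have := le_trans (ler_norm _) (bM h (f h)).
  by rewrite fP -rnorm2 expr2 ler_pM2r.
have bf : f \in bounded_op (H := H).
  apply/asboolP; split.
    move=> c x y; apply: rip_inj => z.
    by rewrite ripDl rip_conjZ -!fP bDl bZl.
  by exists M%:C%C => x; rewrite !normE -rmorphM lecR.
by exists (Bop bf).
Qed.

Lemma exists_adjoint f : exists g :
  'B(H), forall x y, inner (f x) y = inner x (g y).
Proof.
have [M M0 fM] := bop_bound f.
have [|||||g gP] := @bop_of_form (fun y x => rip (f x) y) M.
- by move=> h h' k; rewrite ripDr.
- by move=> h k k'; rewrite bopD ripDl.
- by move=> r h k; rewrite bopZ ripZl.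
- by move=> c h k; rewrite bopZ rip_conjZ conjCK.
- move=> h k; apply: le_trans (rip_le _ _) _.
  by rewrite -mulrA [rnorm h * _]mulrC mulrA ler_wpM2r ?rnorm_ge0.
exists g => x y; apply: inner_ext; first by rewrite gP ripC.
by rewrite gP bopZ ripC.
Qed.

End BoundedForms.

(** * Operator matrices and their quadratic forms *)

Section Contractive.
Context (R : realType) (H : hilbertType R).
Implicit Types (n : nat).

Lemma l2norm2 n (x : 'I_n -> H) : l2norm x ^+ 2 = \sum_i rip (x i) (x i).
Proof.
rewrite /l2norm sqr_sqrtr; last by apply: sumr_ge0 => i _; exact: sqr_ge0.
by apply: eq_bigr => i _; rewrite -rnorm2.
Qed.

Lemma l2norm_ge0 n (x : 'I_n -> H) : 0 <= l2norm x.
Proof. exact: sqrtr_ge0. Qed.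

Lemma opmx_actZ n (S : 'M['B(H)]_n) (c : R[i]) (x : 'I_n -> H) i :
  opmx_act S (fun j => c *: x j) i = c *: opmx_act S x i.
Proof. by rewrite /opmx_act scaler_sumr; apply: eq_bigr => j _;
  rewrite bopZ. Qed.

Lemma l2normZ n (r : R) (x : 'I_n -> H) : 0 <= r ->
  l2norm (fun j => r%:C%C *: x j) = r * l2norm x.
Proof.
move=> r0; apply/eqP; rewrite -(@eqrXn2 _ 2) ?mulr_ge0 ?l2norm_ge0//.
rewrite exprMn !l2norm2 mulr_sumr; apply/eqP; apply: eq_bigr => j _.
by rewrite ripZl ripZr mulrA.
Qed.

Lemma opmx_norm_le1P n (S : 'M['B(H)]_n) : (opmx_norm S <= 1)%E <->
  forall x, l2norm (opmx_act S x) <= l2norm x.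
Proof.
split=> [S1 x|Sx]; last first.
  by apply: ge_ereal_sup => _ [x x1 <-]; rewrite lee_fin (le_trans (Sx x)).
have [x0|x0] := eqVneq (l2norm x) 0.
  have xi0 i : x i = 0.
    apply: rip_eq0; apply/eqP.
    have := l2norm2 x; rewrite x0 expr0n /= => /esym/eqP.
    rewrite psumr_eq0 => [|j _]; last exact: rip_ge0.
    by move=> /allP/(_ i); rewrite mem_index_enum; apply.
  rewrite x0 /l2norm big1 ?sqrtr0// => i _.
  rewrite /opmx_act big1 ?normr0 /= ?expr0n//.
  by move=> j _; rewrite xi0 bop0.
have xp : 0 < l2norm x by rewrite lt_neqAle eq_sym x0 l2norm_ge0.
pose y j := ((l2norm x)^-1)%:C%C *: x j.
have y1 : l2norm y <= 1 by rewrite l2normZ ?invr_ge0 ?l2norm_ge0// mulVf.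
have : ((l2norm (opmx_act S y))%:E <= 1)%E.
  by apply: le_trans S1; apply: ereal_sup_ubound; exists y.
have -> : opmx_act S y = fun i => ((l2norm x)^-1)%:C%C *: opmx_act S x i.
  by apply/funext => i; rewrite opmx_actZ.
by rewrite lee_fin l2normZ ?invr_ge0 ?l2norm_ge0// mulrC ler_pdivrMr// mul1r.
Qed.

Definition vec_join n (x y : 'I_n -> H) : 'I_(n + n) -> H := fun i =>
  match fintype.split i with inl j => x j | inr j => y j end.

Lemma block_form n (A D : 'M['B(H)]_n) (x y : 'I_n -> H) :
  \sum_i inner (opmx_act (block_mx 1%:M A D 1%:M) (vec_join x y) i)
    (vec_join x y i) =
  \sum_i inner (x i + opmx_act A y i) (x i) +
  \sum_i inner (opmx_act D x i + y i) (y i).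
Proof.
have jl i : vec_join x y (lshift n i) = x i.
  by rewrite /vec_join (unsplitK (inl i)).
have jr i : vec_join x y (rshift n i) = y i.
  by rewrite /vec_join (unsplitK (inr i)).
have one (z : 'I_n -> H) i : \sum_j (1%:M : 'M['B(H)]_n) i j (z j) = z i.
  rewrite (bigD1 i)//= mxE eqxx big1 ?addr0// => j ji.
  by rewrite mxE eq_sym (negbTE ji).
rewrite big_split_ord /=; congr (_ + _); apply: eq_bigr => i _.
  rewrite jl; congr (inner _ _); rewrite /opmx_act big_split_ord /=;
    congr (_ + _).
    by rewrite -[RHS]one; apply: eq_bigr => j _; rewrite block_mxEul jl.
  by apply: eq_bigr => j _; rewrite block_mxEur jr.
rewrite jr; congr (inner _ _); rewrite /opmx_act big_split_ord /=;
  congr (_ + _).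
  by apply: eq_bigr => j _; rewrite block_mxEdl jl.
by rewrite -[RHS]one; apply: eq_bigr => j _; rewrite block_mxEdr jr.
Qed.

Lemma Re_sum n (F : 'I_n ->
  R[i]) : complex.Re (\sum_i F i) = \sum_i complex.Re (F i).
Proof. by elim/big_rec2: _ => [|i a b _ <-]//; rewrite Re_D. Qed.

Lemma Im_sum n (F : 'I_n ->
  R[i]) : complex.Im (\sum_i F i) = \sum_i complex.Im (F i).
Proof.
elim/big_rec2: _ => [|i a b _ <-]//; by case: (F i) b => ? ? [].
Qed.

(** The form is |x|^2 + 2 Re <A y, x> + |y|^2 >= |x + A y|^2, because |A y| <= |y|. *)
Lemma block_ge0 n (A D : 'M['B(H)]_n) :
  (forall i j x y, inner (A i j x) y = inner x (D j i y)) ->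
  (opmx_norm A <= 1)%E -> opmx_ge0 (block_mx 1%:M A D 1%:M).
Proof.
move=> AD /opmx_norm_le1P A1 v.
pose x i := v (lshift n i); pose y i := v (rshift n i).
have -> : v = vec_join x y.
  apply/funext => i; rewrite /vec_join; case: fintype.splitP => j ij;
    by congr v; apply: val_inj.
rewrite block_form.
have adj : \sum_i inner (opmx_act D x i) (y i) =
    \sum_i Num.conj (inner (opmx_act A y i) (x i)).
  have sl (w : 'I_n -> H) z : inner (\sum_j w j) z = \sum_j inner (w j) z.
    by elim/big_rec2: _ => [|i a b _ <-]; rewrite ?linear0l ?innerDl.
  under eq_bigr do rewrite /opmx_act sl.
  rewrite exchange_big /=; apply: eq_bigr => i _.
  rewrite -innerC innerC /opmx_act sl rmorph_sum /=; apply: eq_bigr => j _.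
  by rewrite AD -innerC.
under eq_bigr do rewrite innerDl.
rewrite big_split /= [X in _ + X](eq_bigr (fun i =>
  inner (opmx_act D x i) (y i) + inner (y i) (y i))); last first.
  by move=> i _; rewrite innerDl.
rewrite big_split /= adj.
rewrite lecE; apply/andP; split.
  have re (w : 'I_n -> H) : complex.Im (\sum_i inner (w i) (w i)) = 0.
    rewrite Im_sum big1// => i _; rewrite -inner_norm normE.
    by rewrite -rmorphXn.
  rewrite -rmorph_sum /=.
  rewrite !Im_D !re; case: (\sum_i inner _ _) => a b /=.
  by apply/eqP; lra.
rewrite !Re_D !Re_sum /=.
have -> : \sum_i complex.Re (Num.conj (inner (opmx_act A y i) (x i))) =
    \sum_i rip (opmx_act A y i) (x i).
  by apply: eq_bigr => i _; rewrite Re_conj.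
have : 0 <= \sum_i rip (x i + opmx_act A y i) (x i + opmx_act A y i).
  by apply: sumr_ge0 => i _; exact: rip_ge0.
rewrite (eq_bigr (fun i => rip (x i) (x i) + rip (opmx_act A y i) (x i) +
  (rip (opmx_act A y i) (x i) + rip (opmx_act A y i) (opmx_act A y i))));
    last first.
  by move=> i _; rewrite ripDl !ripDr (ripC (x i) (opmx_act A y i)).
rewrite !big_split /=.
have : \sum_i rip (opmx_act A y i) (opmx_act A y i) <= \sum_i rip (y i) (y i).
  by rewrite -!l2norm2 ler_sqr ?nnegrE ?l2norm_ge0.
rewrite /rip; lra.
Qed.

(** Adjointness of D comes out of positivity, so it never has to be shown that theta respects
    adjoints: the form is real, and its imaginary part at i x yields Re <A y, x> = Re <D x, y>. Then
    x = - A y gives |A y|^2 <= |y|^2. *)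
Lemma contractive_of_block_ge0 n (A D : 'M['B(H)]_n) :
  opmx_ge0 (block_mx 1%:M A D 1%:M) -> (opmx_norm A <= 1)%E.
Proof.
move=> AD0; apply/opmx_norm_le1P => y.
have q x : 0 <= \sum_i inner (x i + opmx_act A y i) (x i) +
    \sum_i inner (opmx_act D x i + y i) (y i).
  by rewrite -block_form; exact: AD0.
rewrite -(@ler_sqr _ _ _) ?nnegrE ?l2norm_ge0// !l2norm2.
pose w i := opmx_act A y i.
pose x i := - w i.
have {}q z : complex.Im (\sum_i inner (z i + w i) (z i) +
    \sum_i inner (opmx_act D z i + y i) (y i)) = 0 /\
  0 <= complex.Re (\sum_i inner (z i + w i) (z i) +
    \sum_i inner (opmx_act D z i + y i) (y i)).
  by have := q z; rewrite lecE => /andP[/eqP -> ->].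
have self z : complex.Im (inner z z) = 0 by rewrite -inner_norm normE -rmorphXn.
have im z : \sum_i complex.Im (inner (w i) (z i)) +
    \sum_i complex.Im (inner (opmx_act D z i) (y i)) = 0.
  have [+ _] := q z; rewrite Im_D !Im_sum.
  rewrite (eq_bigr (fun i => complex.Im (inner (w i) (z i)))); last first.
    by move=> i _; rewrite innerDl Im_D self add0r.
  move=> e; rewrite -[RHS]e; congr (_ + _); apply: eq_bigr => i _.
  by rewrite innerDl Im_D self addr0.
have re : \sum_i rip (w i) (x i) = \sum_i rip (opmx_act D x i) (y i).
  have := im (fun i => 'i%C *: x i).
  rewrite (eq_bigr (fun i => - rip (w i) (x i))); last first.
    move=> i _; rewrite Im_inner /rip !innerZr.
    by case: (inner _ _) => a b /=; lra.
  rewrite [X in _ + X](eq_bigr (fun i => rip (opmx_act D x i) (y i)));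
    last first.
    move=> i _; rewrite opmx_actZ innerZl /rip.
    by case: (inner _ _) => a b /=; lra.
  by rewrite sumrN; lra.
have [_] := q x; rewrite Re_D !Re_sum.
rewrite big1; last by move=> i _; rewrite /x addNr linear0l.
rewrite (eq_bigr (fun i => rip (opmx_act D x i) (y i) + rip (y i) (y i)));
  last first.
  by move=> i _; rewrite innerDl Re_D.
rewrite big_split /= -re.
rewrite (eq_bigr (fun i => - rip (w i) (w i))); last first.
  by move=> i _; rewrite /x ripNr.
by rewrite sumrN -/w; lra.
Qed.

Lemma linear_fun0 (theta : 'B(H) -> 'B(H)) : linear theta -> theta 0 = 0.
Proof.
move=> lth; have := lth 1 0 0; rewrite !scale1r addr0 -[LHS]addr0 => /addrI.
by move=> <-.
Qed.

Lemma ucp_contractive (theta : 'B(H) -> 'B(H)) : linear theta ->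
  completely_positive theta -> theta 1 = 1 ->
  forall n (S : 'M['B(H)]_n), (opmx_norm S <= 1)%E ->
    (opmx_norm (map_mx theta S) <= 1)%E.
Proof.
move=> lth cpth th1 n S S1.
have th0 := linear_fun0 lth.
have /choice[adj adjP] (f : 'B(H)) :
    exists g : 'B(H), forall x y, inner (f x) y = inner x (g y).
  exact: exists_adjoint.
pose D : 'M['B(H)]_n := \matrix_(i, j) adj (S j i).
have SD : opmx_ge0 (block_mx 1%:M S D 1%:M).
  by apply: block_ge0 => // i j x y; rewrite mxE.
have th1M : map_mx theta (1%:M : 'M['B(H)]_n) = 1%:M.
  apply/matrixP => i j; rewrite !mxE.
  by case: eqP => _; rewrite ?mulr1n ?mulr0n.
have := cpth _ _ SD; rewrite map_block_mx th1M.
exact: contractive_of_block_ge0.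
Qed.

Lemma ucp_bound (theta : 'B(H) -> 'B(H)) (S : 'B(H)) (M : R) :
  linear theta -> completely_positive theta -> theta 1 = 1 -> 0 < M ->
  (forall x, rnorm (S x) <= M * rnorm x) ->
  forall x, rnorm (theta S x) <= M * rnorm x.
Proof.
move=> lth cpth th1 M0 SM x.
have l1 (f : 'B(H)) (z : H) : l2norm (opmx_act (const_mx f :
  'M['B(H)]_1) (fun=> z)) = rnorm (f z).
  apply/eqP; rewrite -(@eqrXn2 _ 2) ?rnorm_ge0 ?l2norm_ge0// l2norm2 rnorm2.
  by rewrite big_ord1 /opmx_act big_ord1 mxE.
have l1' (z : H) : l2norm (fun _ : 'I_1 => z) = rnorm z.
  apply/eqP; rewrite -(@eqrXn2 _ 2) ?rnorm_ge0 ?l2norm_ge0// l2norm2 rnorm2.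
  by rewrite big_ord1.
have e1 (z : 'I_1 -> H) : z = fun=> z ord0.
  by apply/funext => i; rewrite (ord1 i).
pose S' := (M^-1)%:C%C *: S.
have S'1 : (opmx_norm (const_mx S' : 'M['B(H)]_1) <= 1)%E.
  apply/opmx_norm_le1P => z; rewrite (e1 z) l1 l1'.
  rewrite -[S' _]/((M^-1)%:C%C *: S (z ord0)) rnormZ gtr0_norm ?invr_gt0//.
  by rewrite mulrC ler_pdivrMr// mulrC.
have := ucp_contractive lth cpth th1 S'1.
rewrite (_ : map_mx _ _ = const_mx (theta S')); last first.
  by apply/matrixP => i j; rewrite !mxE.
move=> /opmx_norm_le1P/(_ (fun=> x)); rewrite l1 l1'.
have -> : theta S' = (M^-1)%:C%C *: theta S.
  by have := lth (M^-1)%:C%C S 0; rewrite (linear_fun0 lth) !addr0.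
rewrite -[(_ *: theta S) x]/((M^-1)%:C%C *: theta S x) rnormZ gtr0_norm
  ?invr_gt0//.
by rewrite mulrC ler_pdivrMr// mulrC.
Qed.

Lemma ucp_cb_norm (theta : 'B(H) -> 'B(H)) : linear theta ->
  completely_positive theta -> theta 1 = 1 -> (cb_norm theta <= 1)%E.
Proof.
move=> lth cpth th1; apply: ge_ereal_sup => _ [n [S [S1 ->]]].
exact: ucp_contractive.
Qed.

End Contractive.

(** * The BW-topology on balls *)

(** Half-spaces are convex, hence candidates for [bw_base]; the two signs of s give the two
    one-sided estimates. *)
Lemma continuous_halfspaces (R : realType) (T : topologicalType) (f : T -> R) :
  (forall s c, open [set x | c < s * f x]) -> continuous f.
Proof.
move=> fo x; apply/cvgrPdist_lt => e e0.
have lt : nbhs x [set y | - f x - e < -1 * f y].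
  by apply: open_nbhs_nbhs; split; [exact: fo|rewrite /=; lra].
have gt : nbhs x [set y | f x - e < 1 * f y].
  by apply: open_nbhs_nbhs; split; [exact: fo|rewrite /=; lra].
apply: filterS (filterI lt gt) => y [/= ? ?].
by rewrite ltr_norml; lra.
Qed.

Section BWNeighborhoods.
Context (R : realType) (H : hilbertType R) (X : set 'B(H)).
Implicit Types (theta eta : cbmap X) (S : 'B(H)) (h k : H).

Lemma cbmapP theta : [/\ linear theta, forall S, bicommutant X (theta S) &
  (cb_norm theta < +oo)%E].
Proof. by case: theta => f /= /asboolP. Qed.

Lemma cbmap_ext theta eta : (forall S, theta S = eta S) -> theta = eta.
Proof. by move=> te; apply/val_inj/funext. Qed.

Definition rwfun (p : 'B(H) * H * H) theta : R := rip (theta p.1.1 p.1.2) p.2.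

Lemma Re_wfun S h k theta :
  complex.Re (wfun S h k theta) = rwfun (S, h, k) theta.
Proof. by []. Qed.

Lemma Im_wfun S h k theta :
  complex.Im (wfun S h k theta) = rwfun (S, h, 'i%C *: k) theta.
Proof. exact: Im_inner. Qed.

Lemma rwfun_comb p (a b : R) theta eta :
  rwfun p (a%:C%C *: theta + b%:C%C *: eta) = a * rwfun p theta + b * rwfun p
    eta.
Proof.
rewrite /rwfun -[_ p.1.2]/(a%:C%C *: theta p.1.1 p.1.2 + b%:C%C *: eta p.1.1
  p.1.2).
by rewrite ripDl !ripZl.
Qed.

Lemma bw_base_open (U : set (cbmap X)) : bw_base X U -> open U.
Proof.
move=> bU; exists [set U]; last by rewrite predeqE => t; split=> [[_ ->]|] //;
  exists U.
move=> _ ->; exists [fset U]%fset; first by move=> V /fset1P ->; exact: mem_set.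
rewrite predeqE => t; split=> [|Ut V /fset1P ->//].
by apply; exact/fset1P.
Qed.

Lemma norm_lt_parts (z : R[i]) (e : R) :
  `|complex.Re z| < e -> `|complex.Im z| < e -> `|z| < (2 * e)%:C%C.
Proof.
move=> ze ze'; have e0 : 0 < e by apply: le_lt_trans ze.
rewrite normc_def ltcR -[ltRHS]gtr0_norm ?mulr_gt0// -sqrtr_sqr ltr_sqrt;
  last first.
  by rewrite exprn_gt0// mulr_gt0.
have := ltr_pM (normr_ge0 _) (normr_ge0 _) ze ze.
have := ltr_pM (normr_ge0 _) (normr_ge0 _) ze' ze'.
have sq (a : R) : `|a| * `|a| = a ^+ 2 by rewrite -expr2 real_normK ?num_real.
by rewrite !sq; have := mulr_gt0 e0 e0; lra.
Qed.

Lemma halfspace_open p (s c : R) : open [set theta | c < s * rwfun p theta].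
Proof.
apply: bw_base_open; split.
  apply/convex_setW => eta theta /set_mem /= etac /set_mem /= thetac t t0 t1.
  have tE := ge0_ReE (ltW t0); apply: mem_set => /=.
  have -> : conv t eta theta = (complex.Re t%:num)%:C%C *: eta +
      (1 - complex.Re t%:num)%:C%C *: theta.
    by rewrite rmorphB/= -tE.
  rewrite rwfun_comb.
  move: t0 t1; rewrite tE !ltcR => t0 t1.
  rewrite -subr_gt0 in etac; rewrite -subr_gt0 in thetac.
  rewrite -(subr_gt0 (complex.Re _)) in t1.
  by have := mulr_gt0 t0 etac; have := mulr_gt0 t1 thetac; lra.
move=> r theta _ cth; set d := s * rwfun p theta - c.
have d0 : 0 < d by rewrite subr_gt0.
have s0 : 0 < `|s| + 1 by rewrite ltr_wpDl.
exists [:: p], (d / (`|s| + 1))%:C%C; split; first by rewrite ltcR divr_gt0.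
move=> eta _ /(_ p); rewrite inE eqxx => /(_ isT) h.
have {}h : `|rwfun p eta - rwfun p theta| < d / (`|s| + 1).
  rewrite -ltcR; apply: le_lt_trans h.
  have -> : rwfun p eta - rwfun p theta =
      complex.Re (wfun p.1.1 p.1.2 p.2 eta - wfun p.1.1 p.1.2 p.2 theta).
    by rewrite Re_D Re_N.
  exact: normc_ge_Re.
have {}h : `|s * rwfun p eta - s * rwfun p theta| < d.
  rewrite -mulrBr normrM; apply: le_lt_trans (_ : (`|s| + 1) * _ < _).
    by apply: ler_wpM2r => //; rewrite lerDl.
  by rewrite mulrC -ltr_pdivlMr.
by move: h; rewrite /d ltr_norml => /andP[h _] /=; lra.
Qed.


Lemma rwfun_continuous p : continuous (rwfun p).
Proof. exact: continuous_halfspaces (halfspace_open p). Qed.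

Definition close_on (s : seq ('B(H) * H * H)) (e : R) theta eta :=
  forall p, p \in s -> `|rwfun p eta - rwfun p theta| < e.

(** A neighbourhood contains a finite intersection of sets of [bw_base], each contributing a finite
    list of coordinates because theta lies in the ball. Complex coordinates are split into real ones
    at k and i k, at the price of halving the tolerance. *)
Lemma bw_nbhs_ball (r : R) theta (U : set (cbmap X)) :
  nbhs theta U -> cb_ball r theta ->
  exists s e, 0 < e /\ forall eta, cb_ball r eta -> close_on s e theta eta ->
    U eta.
Proof.
rewrite nbhsE => -[_ [[B sB <-] [C BC Ct]] CU] rt.
have /sB [D sD IDC] := BC.
suff [s [e [e0 sD']]] : exists s e, 0 < e /\ forall eta, cb_ball r eta ->
    close_on s e theta eta -> forall V, V \in enum_fset D -> V eta.
  exists s, e; split=> // eta reta ste; apply: CU.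
  suff Ceta : C eta by exists C.
  by rewrite -IDC => V DV; exact: sD' ste V DV.
have : forall V, V \in enum_fset D -> bw_base X V /\ V theta.
  move=> V DV; split; first by have /sD/set_mem := DV.
  by move: Ct; rewrite -IDC => /(_ _ DV).
elim: (enum_fset D) => [_|V l IH lP]; first by exists [::], 1; split.
have [|s [e [e0 sl]]] := IH.
  by move=> W Wl; apply: lP; rewrite inE Wl orbT.
have [[_ /(_ r) wV] Vt] := lP V (mem_head _ _).
have [s' [e' [e'0 sV]]] := wV _ rt Vt.
pose i (p : 'B(H) * H * H) := (p.1.1, p.1.2, 'i%C *: p.2).
pose d := Num.min e (complex.Re e' / 2).
have re0 : 0 < complex.Re e' by have := e'0;
  rewrite {1}(ge0_ReE (ltW e'0)) ltcR.
exists (s ++ s' ++ map i s'), d; split.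
  by rewrite lt_min e0 divr_gt0.
move=> eta reta close W; rewrite inE => /orP[/eqP ->|Wl].
  apply: sV => // p ps'.
  rewrite (ge0_ReE (ltW e'0)) -[complex.Re e'](@divfK _ 2)// mulrC.
  apply: norm_lt_parts.
    rewrite Re_D Re_N !Re_wfun; apply: lt_le_trans (close _ _) _.
      by rewrite !mem_cat; case: (p) ps' => -[S h] k /= ->; rewrite orbT.
    by rewrite ge_min lexx orbT.
  rewrite Im_D Im_N !Im_wfun; apply: lt_le_trans (close (i p) _) _.
    by rewrite !mem_cat map_f ?orbT.
  by rewrite ge_min lexx orbT.
apply: (sl eta) Wl => // p ps; apply: lt_le_trans (close _ _) _.
  by rewrite mem_cat ps.
by rewrite ge_min lexx.
Qed.

End BWNeighborhoods.

(** * Compactness of the weak expectations *)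

Lemma ultra_fmap (T U : Type) (f : T -> U) (F : set_system T) :
  UltraFilter F -> UltraFilter (f @ F).
Proof.
move=> UF; have FF : ProperFilter F := ultra_proper.
split=> [|G GG FG]; first exact: fmap_proper_filter.
apply/seteqP; split=> [B GB|//].
have [//|FnB] := in_ultra_setVsetC (f @^-1` B) UF.
have GnB : G (~` B) by exact: FG.
by have [y []] := filter_ex (filterI GB GnB).
Qed.

Lemma ultra_bounded_cvg (R : realType) (T : Type) (F : set_system T)
    (g : T -> R) (M : R) : UltraFilter F -> (forall x, `|g x| <= M) ->
  exists l : R, g x @[x --> F] --> l.
Proof.
move=> UF gM; have := @segment_compact R (- M) M.
rewrite compact_ultra => /(_ _ (ultra_fmap g UF)).
case=> [|l [_ Fl]]; last by exists l.
by apply: (@filterE _ F) => x /=; rewrite in_itv/= -ler_norml gM.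
Qed.

Section WeakExpectationsCompact.
Context (R : realType) (A : cstarAlgType R) (H : hilbertType R).
Context (pi : A -> 'B(H)).
Implicit Types (x y : WE pi) (S : 'B(H)) (h k : H).

Let thetaP x : [/\ linear (set_val x), completely_positive (set_val x),
  set_val x 1 = 1 & forall a, set_val x (pi a) = pi a].
Proof.
have [cp u f] : WE pi (set_val x) by exact: set_mem (valP x).
by have [l _ _] := cbmapP (set_val x); split.
Qed.

Lemma WE_cb_ball x : cb_ball 1 (set_val x).
Proof. by have [l cp u _] := thetaP x; exact: ucp_cb_norm. Qed.

Definition wfunT (p : 'B(H) * H * H) x : R := rwfun p (set_val x).

Lemma wfunT_continuous p : continuous (wfunT p).
Proof.
move=> x; apply: (@continuous_comp (WE pi) (cbmap (range pi)) R set_val (rwfun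
  p)).
  exact: initial_continuous.
exact: rwfun_continuous.
Qed.

Lemma wfunT_bound S : exists M : R, forall x h k,
  `|wfunT (S, h, k) x| <= M * rnorm h * rnorm k.
Proof.
have [M M0 SM] := bop_bound S; exists M => x h k.
have [l cp u _] := thetaP x.
apply: le_trans (rip_le _ _) _.
by rewrite ler_wpM2r ?rnorm_ge0//; exact: ucp_bound.
Qed.

Lemma WE_nbhs x (U : set (WE pi)) : nbhs x U ->
  exists (s : seq ('B(H) * H * H)) (e : R), 0 < e /\
    forall y, (forall p, p \in s -> `|wfunT p y - wfunT p x| < e) -> U y.
Proof.
rewrite nbhsE => -[W [[V oV VW] Wx] WU].
have Vx : nbhs (set_val x) V by apply: open_nbhs_nbhs; split=> //; move: Wx;
  rewrite -VW.
have [s [e [e0 sV]]] := bw_nbhs_ball Vx (WE_cb_ball x).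
exists s, e; split=> // y ys; apply: WU; rewrite -VW.
by apply: sV => //; exact: WE_cb_ball.
Qed.

(** For each v, positivity becomes a closed condition on finitely many real coordinates, so that it
    survives pointwise limits. *)
Lemma opmx_ge0P n (S : 'M['B(H)]_n) : opmx_ge0 S <->
  forall v : 'I_n -> H, 0 <= \sum_i \sum_j rip (S i j (v j)) (v i) /\
    \sum_i \sum_j rip (S i j (v j)) ('i%C *: v i) = 0.
Proof.
have rE v (w : 'I_n -> H) : \sum_i \sum_j rip (S i j (v j)) (w i) =
    \sum_i rip (opmx_act S v i) (w i).
  by apply: eq_bigr => i _; rewrite rip_suml.
have iff v : (0 <= \sum_i inner (opmx_act S v i) (v i)) <->
    0 <= \sum_i \sum_j rip (S i j (v j)) (v i) /\
    \sum_i \sum_j rip (S i j (v j)) ('i%C *: v i) = 0.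
  rewrite lecE Im_sum Re_sum !rE.
  rewrite (eq_bigr (fun i => rip (opmx_act S v i) ('i%C *: v i))); last first.
    by move=> i _; rewrite Im_inner.
  by split=> [/andP[/eqP ? ?]|[? /eqP ?]]; [split|apply/andP].
by split=> S0 v; apply/iff.
Qed.

Lemma WE_compact : compact [set: WE pi].
Proof.
rewrite compact_ultra => F UF _.
have FF : ProperFilter F := ultra_proper.
have /choice[L LP] (p : 'B(H) * H * H) : exists l : R, wfunT p x @[x --> F] -->
  l.
  case: p => -[S h] k; have [M SM] := wfunT_bound S.
  exact: ultra_bounded_cvg (fun x => SM x h k).
(* Identities and bounds shared by the coordinates of all weak expectations pass to the limits; what
   is required of the limit map is cast in this form. *)
have Luniq p (l : R) : wfunT p x @[x --> F] --> l -> L p = l.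
  by move=> pl; apply: cvg_unique (LP p) pl; exact: Rhausdorff.
have LPE p q : wfunT p =1 wfunT q -> L p = L q.
  by move=> pq; apply: Luniq; rewrite (funext pq); exact: LP.
have LD p q r : (forall x, wfunT r x = wfunT p x + wfunT q x) ->
  L r = L p + L q.
  move=> pqr; apply: Luniq; rewrite (funext pqr).
  by apply: cvgD; exact: LP.
have LZ (a : R) p q : (forall x, wfunT q x = a * wfunT p x) -> L q = a * L p.
  move=> pq; apply: Luniq; rewrite (funext pq).
  by apply: cvgMr; exact: LP.
have Lle p (M : R) : (forall x, `|wfunT p x| <= M) -> `|L p| <= M.
  move=> pM; rewrite ler_norml; apply/andP; split.
    apply: (closed_cvg (fun r : R => - M <= r) _ _ _ (LP p)).
      exact: closed_ge.
    by apply: filterE => x; have := pM x; rewrite ler_norml => /andP[].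
  apply: (closed_cvg (fun r : R => r <= M) _ _ _ (LP p)).
    exact: closed_le.
  by apply: filterE => x; have := pM x; rewrite ler_norml => /andP[].
have /choice[th thP] S : exists f :
  'B(H), forall h k, L (S, h, k) = rip (f h) k.
  have [M SM] := wfunT_bound S.
  apply: (@bop_of_form _ _ (fun h k => L (S, h, k)) M).
  - by move=> h h' k; apply: LD => x; rewrite /wfunT /rwfun/= bopD ripDl.
  - by move=> h k k'; apply: LD => x; rewrite /wfunT /rwfun/= ripDr.
  - by move=> r h k; apply: LZ => x; rewrite /wfunT /rwfun/= ripZr.
  - by move=> c h k; apply: LPE => x; rewrite /wfunT /rwfun/= bopZ rip_conjZ.
  - by move=> h k; apply: Lle => x; exact: SM.
have bop_rip_ext (f g : 'B(H)) : (forall h k, rip (f h) k = rip (g h) k) ->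
  f = g.
  by move=> fg; apply: bop_ext => h; apply: rip_inj => k.
have lth : linear th.
  move=> c S S'; apply: bop_rip_ext => h k.
  have -> : (c *: th S + th S') h = c *: th S h + th S' h by [].
  rewrite ripDl rip_conjZ -!thP.
  apply: LD => x; have [l _ _ _] := thetaP x.
  rewrite /wfunT /rwfun/= l.
  have -> : (c *: set_val x S + set_val x S') h =
    c *: set_val x S h + set_val x S' h by [].
  by rewrite ripDl rip_conjZ.
have th1 : th 1 = 1.
  apply: bop_rip_ext => h k; rewrite -thP; apply: Luniq.
  rewrite (_ : wfunT _ = cst (rip h k)); first exact: cvg_cst.
  by apply/funext => x; have [_ _ u _] := thetaP x; rewrite /wfunT /rwfun/= u.
have thpi a : th (pi a) = pi a.
  apply: bop_rip_ext => h k; rewrite -thP; apply: Luniq.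
  rewrite (_ : wfunT _ = cst (rip (pi a h) k)); first exact: cvg_cst.
  by apply/funext => x; have [_ _ _ u] := thetaP x; rewrite /wfunT /rwfun/= u.
have Lsum n (S : 'M['B(H)]_n) (v w : 'I_n -> H) :
    (\sum_i \sum_j wfunT (S i j, v j, w i) x) @[x --> F] -->
    \sum_i \sum_j rip (th (S i j) (v j)) (w i).
  apply: cvg_big => [|i _]; first exact: add_continuous.
  apply: cvg_big => [|j _]; first exact: add_continuous.
  by rewrite -thP; exact: LP.
have cpth : completely_positive th.
  move=> n S S0; apply/opmx_ge0P => v.
  have xS0 x := (opmx_ge0P _).1 (let: And4 _ cp _ _ := thetaP x in cp n S S0) v.
  under eq_bigr do under eq_bigr do rewrite mxE.
  under [X in _ /\ X = _]eq_bigr do under eq_bigr do rewrite mxE.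
  split.
    apply: (closed_cvg (fun r : R => 0 <= r) _ _ _ (Lsum n S v v)).
      exact: closed_ge.
    apply: filterE => x; have [+ _] := xS0 x.
    by under eq_bigr do under eq_bigr do rewrite mxE.
  apply: cvg_unique (Lsum n S v (fun i => 'i%C *: v i)) _;
    first exact: Rhausdorff.
  rewrite [X in X @ _](_ : _ = cst 0); first exact: cvg_cst.
  apply/funext => x; have [_] := xS0 x.
  by under eq_bigr do under eq_bigr do rewrite mxE.
have thbi S : bicommutant (range pi) (th S).
  move=> Q QX; apply: bop_rip_ext => h k.
  (* Through the adjoint Q', commutation with Q becomes the equality of two coordinates, at (Q h, k)
     and at (h, Q' k). *)
  have [Q' QQ'] := exists_adjoint Q.
  have ripQ u v : rip (Q u) v = rip u (Q' v) by rewrite /rip QQ'.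
  have -> : (th S * Q) h = th S (Q h) by [].
  have -> : (Q * th S) h = Q (th S h) by [].
  rewrite ripQ -!thP.
  apply: LPE => x; rewrite /wfunT /rwfun/= -ripQ.
  have [_ /(_ S Q QX) c _] := cbmapP (set_val x).
  have -> : set_val x S (Q h) = (set_val x S * Q) h by [].
  by rewrite c.
have thcb : th \in cb_map (range pi).
  apply/asboolP; split=> //.
  by apply: le_lt_trans (ucp_cb_norm lth cpth th1) _; exact: ltry.
pose theta : cbmap (range pi) := CBMap thcb.
have WEth : WE pi theta by split.
exists (SigSub (mem_set WEth)); split=> // U /WE_nbhs[s [e [e0 sU]]].
suff : F [set y | forall p, p \in s -> `|wfunT p y - L p| < e].
  apply: filterS => y ys; apply: sU => p /ys.
  by case: (p) => -[S h] k; rewrite thP.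
elim: s {sU} => [|p s IH]; first by apply: filterE => y p; rewrite in_nil.
have /cvgrPdist_lt/(_ _ e0) := LP p => pF.
apply: filterS (filterI pF IH) => y [yp ys] q;
  rewrite inE => /orP[/eqP->|/ys//].
by rewrite distrC.
Qed.

End WeakExpectationsCompact.

(** * Representing measures of weak expectations *)

Section WeakExpectationsConvex.
Context (R : realType) (A : cstarAlgType R) (H : hilbertType R).
Context (pi : A -> 'B(H)).
Implicit Types (x y z : WE pi) (p : 'B(H) * H * H).

Definition WE_comb (t : R) y z x : Prop :=
  set_val x = t%:C%C *: set_val y + (1 - t)%:C%C *: set_val z.

(** The values a = 1 and a = -1 together say that the coordinate is affine. *)
Lemma wfunT_affine p (a : R) : ccv WE_comb (a \*o wfunT p).
Proof.
split; first by apply: continuous_fctZ; exact: wfunT_continuous.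
by move=> t y z x _ e; rewrite /= /wfunT e rwfun_comb; lra.
Qed.

Lemma WE_separated x y : x <> y ->
  exists2 w : WE pi -> R, ccv WE_comb w & w x <> w y.
Proof.
move=> xy; apply: contrapT => nw; apply: xy; apply/val_inj/cbmap_ext => S.
apply: bop_ext => h; apply: rip_inj => k; apply: contrapT => ne; apply: nw.
exists (1 \*o wfunT (S, h, k)); first exact: wfunT_affine.
by rewrite /= !mul1r.
Qed.

(** The concave function is the minimum of 1 and of e - |wfunT p y - wfunT p x| over p in s, each
    absolute value being written as two affine terms. *)
Lemma WE_base x (U : set (WE pi)) : nbhs x U -> exists w : WE pi -> R,
  [/\ ccv WE_comb w, 0 < w x & forall y, 0 < w y -> U y].
Proof.
move=> /WE_nbhs[s [e [e0 sU]]].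
suff [w [cw wx ws]] : exists w : WE pi -> R, [/\ ccv WE_comb w, 0 < w x &
    forall y, 0 < w y -> forall p, p \in s -> `|wfunT p y - wfunT p x| < e].
  by exists w; split=> // y /ws; exact: sU.
elim: s {sU} => [|p s [w [cw wx ws]]].
  by exists (cst 1); split=> //=; exact: ccv_cst.
exists (w \min ((cst (e + wfunT p x) + -1 \*o wfunT p) \min
                (cst (e - wfunT p x) + 1 \*o wfunT p))); split.
- by apply: ccv_min => //; apply: ccv_min; apply: ccvD;
    by [exact: ccv_cst|exact: wfunT_affine].
- by rewrite /= !fctE/= !lt_min wx /=; apply/andP; split; lra.
- move=> y; rewrite /= !fctE/= !lt_min => /and3P[wy y1 y2] q.
  rewrite inE => /orP[/eqP->|]; last exact: ws.
  by rewrite ltr_norml; lra.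
Qed.

(** This lets a set that misses the extreme points miss [ext_points] as well. A complex t with 0 < t
    < 1 is real, so the two notions of convex combination match. *)
Lemma WE_ext_points x : ext_points WE_comb x ->
  extreme_points (WE pi) (set_val x).
Proof.
move=> xext; split; first exact: set_mem (valP x).
move=> y z t WEy WEz /andP[t0 t1] xE.
have tE := ge0_ReE (ltW t0).
have t01 : 0 < complex.Re t < 1.
  by move: t0 t1; rewrite tE !ltcR => -> ->.
have := xext _ (SigSub (mem_set WEy)) (SigSub (mem_set WEz)) t01.
case=> [|yx zx]; first by rewrite /WE_comb xE rmorphB/= -tE.
by split; [rewrite -yx|rewrite -zx].
Qed.

End WeakExpectationsConvex.

Theorem theorem3p5 (R : realType) (A : cstarAlgType R) (H : hilbertType R)
    (pi : A -> 'B(H)) (pi_rep : representation pi)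
    (pi_nondeg : nondegenerate_rep pi) (WE_nonempty : WE pi !=set0)
    (phi : WE pi) :
  exists mu : probability (baireType R phi) R,
    (forall B : set (baireType R phi), measurable B ->
       (set_val @` (B : set (WE pi))) `&` extreme_points (WE pi) = set0 ->
       mu B = 0%E) /\
    (forall (S : 'B(H)) (h k : H),
       let f : baireType R phi -> R[i] :=
         fun theta : WE pi => wfun S h k (set_val theta) in
       cintegrable mu f /\ wfun S h k (set_val phi) = cintegral mu f).
Proof.
have [mu [mu0 mu_int]] := choquet_bishop_deleeuw (@WE_compact R A H pi) phi
  (@WE_separated R A H pi) (@WE_base R A H pi).
exists mu; split=> [B mB Bext|S h k f].
  apply: mu0; apply/seteqP; split=> // x [Bx /WE_ext_points xext].
  suff : set0 (set_val x) by [].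
  by rewrite -Bext; split=> //; exists x.
have part p : mu.-integrable setT (EFin \o (wfunT p : baireType R phi -> R)) /\
    \int[mu]_x wfunT p x = wfunT p phi.
  apply: mu_int; last exact: wfunT_affine.
  have := wfunT_affine pi p 1; congr (ccv _ _).
  by apply/funext => x; rewrite /= mul1r.
have fRe : (fun x => complex.Re (f x)) = wfunT (S, h, k) by [].
have fIm : (fun x => complex.Im (f x)) = wfunT (S, h, 'i%C *: k).
  by apply/funext => x; exact: Im_wfun.
have [iRe eRe] := part (S, h, k).
have [iIm eIm] := part (S, h, 'i%C *: k).
split; first by split; [exact: iRe|move: iIm; rewrite -fIm].
rewrite /cintegral fIm fRe eRe eIm /wfunT -Re_wfun -Im_wfun.
by case: (wfun _ _ _ _).
Qed.
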